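(* Let $a<b$ be real, let $g$ be a nonnegative real function on $[-1,1]$ that is analytic in the disc $|z|<r$ for some $r>1$, let $\phi_\omega(x)=\sin(\omega x)$ or $\phi_\omega(x)=\cos(\omega x)$, and define $$\rho_0=2\sum_{k=0}^\infty \frac{g^{(2k)}(0)}{(k!)^2\,4^k},\qquad I_O[f]=\int_a^b f(x)\Big[(g\circ\phi_\omega)(x)-\frac{\rho_0}{2}\Big]dx .$$ Let $n$ be an even positive integer. Suppose that for all sufficiently large $\omega$ there exists a monic polynomial $q_n^\omega$ of degree $n$ with $\int_a^b q_n^\omega(x)x^j\big[(g\circ\phi_\omega)(x)-\rho_0/2\big]dx=0$ for $j=0,\ldots,n-1$, whose zeros $x_1,\ldots,x_n$ (possibly complex) are distinct, and let $w_1,\ldots,w_n$ be weights such that $\sum_{k=1}^n w_k p(x_k)=I_O[p]$ for every polynomial $p$ of degree at most $2n-1$ (the Gaussian rule). Suppose that the nodes can be split into two groups $\{\check{x}_k\}_{k=1}^{n/2}$ and $\{\hat{x}_k\}_{k=1}^{n/2}$ satisfying $$\check{x}_k=a+O(\omega^{-1}),\qquad \hat{x}_k=b+O(\omega^{-1}),\qquad k=1,\ldots,n/2,$$ as $\omega\to\infty$. Then for every function $f$ analytic in a (complex) region containing $[a,b]$, $$I_O[f]-\sum_{k=1}^n w_k f(x_k)=O(\omega^{-n-1}),\qquad \omega\to\infty.$$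
   Context: The integral $\int_a^b f(x)(g\circ\phi_\omega)(x)\,dx$ is split as $I_O[f]+\frac{\rho_0}{2}\int_a^b f(x)\,dx$; the constant $\rho_0$ is the limit value such that $\int_a^b f(x)(g\circ\phi_\omega)(x)dx\to\frac{\rho_0}{2}\int_a^b f(x)dx$ as $\omega\to\infty$. Since $(g\circ\phi_\omega)-\rho_0/2$ may change sign, existence of $q_n^\omega$ is an assumption. All $O(\cdot)$ statements refer to $\omega\to\infty$ with $n$, $f$, $g$, $a$, $b$ fixed. *)

(* Defs.v *)
From Stdlib Require Import Reals List Arith Factorial.
From Coquelicot Require Import Coquelicot.
Open Scope R_scope.

Definition phi (s : bool) (om x : R) : R :=
  if s then sin (om * x) else cos (om * x).

Definition rho0 (g : R -> R) : R :=
  2 * Series (fun k => Derive_n g (2 * k) 0 / ((INR (fact k)) ^ 2 * 4 ^ k)).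

Definition osc_weight (g : R -> R) (s : bool) (om x : R) : R :=
  g (phi s om x) - rho0 g / 2.

Definition I_O (a b : R) (g : R -> R) (s : bool) (om : R) (f : C -> C) : C :=
  @RInt C_R_CompleteNormedModule
    (fun x : R => Cmult (f (RtoC x)) (RtoC (osc_weight g s om x))) a b.

Definition Csum (n : nat) (u : nat -> C) : C :=
  fold_right Cplus (RtoC 0) (map u (seq 0 n)).
Definition Cprod (n : nat) (u : nat -> C) : C :=
  fold_right Cmult (RtoC 1) (map u (seq 0 n)).

Definition holo_at (F : C -> C) (z : C) : Prop :=
  ex_derive (K := C_AbsRing) (V := C_NormedModule) F z.

(* Main.v *)
(** The error of the Gaussian rule is [I_O] of [F - P], where [P] is the Newton (Hermite)
    interpolant of degree [2n-1] at the nodes taken twice: [F - P = q^2 h] with [h] holomorphic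
    and bounded, uniformly in omega, near [[a,b]].  Since [rho0 g / 2] is the mean of the periodic
    function [g o phi], the weight has bounded periodic antiderivatives of every order, and [n+1]
    integrations by parts express the error through the derivatives of order [j <= n] of [q^2 h] at
    the endpoints (with factor omega^(-j-1)) and a remainder O(omega^(-n-1)).  On the discs of
    radius 1/omega around [a] and [b] the function [q^2 h] is O(omega^(-n)), so by Cauchy's
    estimates its [j]-th derivative there is O(omega^(j-n)).

    Taylor expansions come from Goursat's argument carried out on the contraction
    [zeta + t (rho e^(i theta) - zeta)] of a circle to an interior point [zeta], which gives
    Cauchy's formula without a singular point. *)
Require Import Defs.
From Stdlib Require Import Reals List Arith Factorial Lra Lia Classical ClassicalEpsilon.
From Coquelicot Require Import Coquelicot.
Open Scope R_scope.

Local Notation CV := C_R_CompleteNormedModule (only parsing).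
Local Notation ccont f := (continuous (T := R_UniformSpace) (U := C_UniformSpace) f) (only parsing).
Local Notation CInt f a b := (RInt (V := CV) f a b : C) (only parsing).

(** * Continuity, integrals of complex-valued functions, Goursat on rectangles *)

(** The nodes move with omega, and the cofactor [h] moves with them, so every estimate must be
    uniform in the nodes. This is why [h] is reached by repeated divided differences: each costs a
    fixed factor wherever its node lies in the region. The coefficients of the interpolant are never
    estimated; it enters only through its degree, which makes the rule exact on it, and through its
    agreement with [F] at the nodes.

    The order n+1 comes from a balance. Near each endpoint only half of the n factors of q are
    O(1/omega), and squaring q restores the power n. Differentiation on the scale 1/omega loses one
    power of omega, which is what one integration by parts gains, so all boundary terms have the
    same size omega^(-n-1). Away from the endpoints q^2 h is merely bounded; there only its
    derivative of order n+1 is needed, and Cauchy's estimate for it uses discs of a fixed radius.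

    The nodes may be complex, so holomorphy is used in a complex neighbourhood, whereas the
    integrations by parts act on the real and imaginary parts along [a,b]. *)

Lemma continuous_pair {U V W : UniformSpace} (f : U -> V) (g : U -> W) (x : U) :
  continuous f x -> continuous g x ->
  continuous (U := prod_UniformSpace V W) (fun t => (f t, g t)) x.
Proof.
  intros Hf Hg.
  apply (continuous_comp_2 (X := prod_UniformSpace V W) f g pair); trivial.
  apply continuous_ext with (fun z => z).
  - intros [u v]; reflexivity.
  - apply continuous_id.
Qed.

Lemma continuous_fst_comp {U : UniformSpace} (f : U -> C) (x : U) :
  continuous (U := C_UniformSpace) f x ->
  continuous (U := R_UniformSpace) (fun t => fst (f t)) x.
Proof.
  intros Hf; apply (continuous_comp f fst x Hf).
  destruct (f x); apply (continuous_fst (U := R_UniformSpace) (V := R_UniformSpace)).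
Qed.

Lemma continuous_snd_comp {U : UniformSpace} (f : U -> C) (x : U) :
  continuous (U := C_UniformSpace) f x ->
  continuous (U := R_UniformSpace) (fun t => snd (f t)) x.
Proof.
  intros Hf; apply (continuous_comp f snd x Hf).
  destruct (f x); apply (continuous_snd (U := R_UniformSpace) (V := R_UniformSpace)).
Qed.

Lemma continuous_Cplus {U : UniformSpace} (f g : U -> C) (x : U) :
  continuous (U := C_UniformSpace) f x -> continuous (U := C_UniformSpace) g x ->
  continuous (U := C_UniformSpace) (fun t => (f t + g t)%C) x.
Proof.
  intros Hf Hg; apply (continuous_pair (V := R_UniformSpace) (W := R_UniformSpace));
  apply (continuous_plus (V := R_NormedModule));
  auto using continuous_fst_comp, continuous_snd_comp.
Qed.

Lemma continuous_Cmult {U : UniformSpace} (f g : U -> C) (x : U) :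
  continuous (U := C_UniformSpace) f x -> continuous (U := C_UniformSpace) g x ->
  continuous (U := C_UniformSpace) (fun t => (f t * g t)%C) x.
Proof.
  intros Hf Hg; apply (continuous_pair (V := R_UniformSpace) (W := R_UniformSpace)).
  - apply (continuous_minus (V := R_NormedModule));
    apply (continuous_mult (K := R_AbsRing));
    auto using continuous_fst_comp, continuous_snd_comp.
  - apply (continuous_plus (V := R_NormedModule));
    apply (continuous_mult (K := R_AbsRing));
    auto using continuous_fst_comp, continuous_snd_comp.
Qed.

Lemma continuous_RtoC {U : UniformSpace} (f : U -> R) (x : U) :
  continuous (U := R_UniformSpace) f x ->
  continuous (U := C_UniformSpace) (fun t => RtoC (f t)) x.
Proof.
  intros Hf; apply (continuous_pair (V := R_UniformSpace) (W := R_UniformSpace)); trivial.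
  apply continuous_const.
Qed.

Lemma continuous_Cinv {U : UniformSpace} (f : U -> C) (x : U) :
  continuous (U := C_UniformSpace) f x -> f x <> 0%C ->
  continuous (U := C_UniformSpace) (fun t => (/ f t)%C) x.
Proof.
  intros Hf Hn.
  assert (Hd : fst (f x) ^ 2 + snd (f x) ^ 2 <> 0).
  { intros H0; apply Hn; destruct (f x) as [u v]; simpl in *.
    apply injective_projections; simpl; nra. }
  assert (Hc : continuous (U := R_UniformSpace)
    (fun t => / (fst (f t) ^ 2 + snd (f t) ^ 2)) x).
  { apply (continuous_comp (V := R_UniformSpace) (W := R_UniformSpace)
      (fun t => fst (f t) ^ 2 + snd (f t) ^ 2) Rinv).
    - assert (Hsq : forall v : U -> R, continuous (U := R_UniformSpace) v x ->
        continuous (U := R_UniformSpace) (fun t => v t ^ 2) x).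
      { intros v Hv; apply (continuous_comp (V := R_UniformSpace) v (fun y => y ^ 2) x Hv).
        apply (ex_derive_continuous (K := R_AbsRing) (V := R_NormedModule)); auto_derive; trivial. }
      apply (continuous_plus (V := R_NormedModule));
      apply Hsq; [apply continuous_fst_comp|apply continuous_snd_comp]; exact Hf.
    - apply continuity_pt_filterlim, continuity_pt_inv; trivial.
      apply derivable_continuous_pt, derivable_pt_id. }
  apply (continuous_pair (V := R_UniformSpace) (W := R_UniformSpace)).
  - apply (continuous_mult (K := R_AbsRing)); auto using continuous_fst_comp.
  - apply (continuous_mult (K := R_AbsRing)); trivial.
    apply (continuous_opp (V := R_NormedModule)); auto using continuous_snd_comp.
Qed.

Lemma ex_CInt (f : R -> C) (a b : R) :
  a <= b -> (forall t, a <= t <= b -> ccont f t) -> ex_RInt (V := CV) f a b.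
Proof.
  intros Hab H; apply (ex_RInt_continuous (V := CV)); intros z Hz.
  rewrite Rmin_left, Rmax_right in Hz by trivial; apply H, Hz.
Qed.

Lemma is_CInt_mult_l (c : C) (f : R -> C) (a b : R) (l : C) :
  is_RInt (V := CV) f a b l -> is_RInt (V := CV) (fun t => (c * f t)%C) a b (c * l)%C.
Proof.
  intros H.
  pose proof (is_RInt_fct_extend_fst (U := R_NormedModule) (V := R_NormedModule) f a b l H) as H1.
  pose proof (is_RInt_fct_extend_snd (U := R_NormedModule) (V := R_NormedModule) f a b l H) as H2.
  apply (is_RInt_fct_extend_pair (U := R_NormedModule) (V := R_NormedModule)
    (fun t => (c * f t)%C) a b (fst (c * l)%C) (snd (c * l)%C)); simpl.
  - apply (is_RInt_minus (V := R_NormedModule)); apply (is_RInt_scal (V := R_NormedModule)); trivial.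
  - apply (is_RInt_plus (V := R_NormedModule)); apply (is_RInt_scal (V := R_NormedModule)); trivial.
Qed.

Lemma CInt_mult_l (c : C) (f : R -> C) (a b : R) :
  ex_RInt (V := CV) f a b ->
  RInt (V := CV) (fun t => (c * f t)%C) a b = (c * RInt (V := CV) f a b)%C.
Proof.
  intros H; apply is_RInt_unique, is_CInt_mult_l, (RInt_correct (V := CV)), H.
Qed.

Lemma CInt_bound (f : R -> C) (a b M : R) :
  a <= b -> ex_RInt (V := CV) f a b -> (forall t, a <= t <= b -> Cmod (f t) <= M) ->
  Cmod (RInt (V := CV) f a b) <= (b - a) * M.
Proof.
  intros Hab Hex H; rewrite Cmod_norm.
  apply (norm_RInt_le_const (V := CV) f a b); trivial.
  - intros t Ht; specialize (H t Ht); rewrite Cmod_norm in H; exact H.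
  - apply (RInt_correct (V := CV)), Hex.
Qed.

Lemma CInt_Chasles (f : R -> C) (a b c : R) :
  ex_RInt (V := CV) f a b -> ex_RInt (V := CV) f b c ->
  (RInt (V := CV) f a b + RInt (V := CV) f b c)%C = RInt (V := CV) f a c.
Proof. exact (RInt_Chasles (V := CV) f a b c). Qed.

Lemma nested_intervals (u v : nat -> R) :
  (forall k, u k <= u (S k)) -> (forall k, v (S k) <= v k) -> (forall k, u k <= v k) ->
  exists l, forall k, u k <= l <= v k.
Proof.
  intros Hu Hv Huv.
  assert (Hu' : forall j d, u j <= u (j + d)%nat).
  { intros j d; induction d; [rewrite Nat.add_0_r; lra|].
    rewrite Nat.add_succ_r; specialize (Hu (j + d)%nat); lra. }
  assert (Hv' : forall j d, v (j + d)%nat <= v j).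
  { intros j d; induction d; [rewrite Nat.add_0_r; lra|].
    rewrite Nat.add_succ_r; specialize (Hv (j + d)%nat); lra. }
  assert (Hj : forall j k, u j <= v k).
  { intros j k; specialize (Hu' j k); specialize (Hv' k j); specialize (Huv (j + k)%nat).
    rewrite (Nat.add_comm k j) in Hv'; lra. }
  destruct (completeness (fun y => exists k, y = u k)) as [l [Hl1 Hl2]].
  - exists (v 0%nat); intros y [k ->]; apply Hj.
  - exists (u 0%nat); exists 0%nat; reflexivity.
  - exists l; intros k; split.
    + apply Hl1; exists k; reflexivity.
    + apply Hl2; intros y [j ->]; apply Hj.
Qed.

(** The integral of the form P dx + Q dy counterclockwise along the boundary of [x, x+w] x [y, y+h].
    [P] and [Q] are left unrelated so that the definition covers a form pulled back to polar-like
    coordinates. *)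
Definition rect_int (P Q : R -> R -> C) (x y w h : R) : C :=
  (RInt (V := CV) (fun t => P t y) x (x + w)
   + RInt (V := CV) (fun t => Q (x + w)%R t) y (y + h)
   - RInt (V := CV) (fun t => P t (y + h)%R) x (x + w)
   - RInt (V := CV) (fun t => Q x t) y (y + h))%C.

(** Bisection: some quarter of each rectangle carries at least a quarter of the modulus of the
    boundary integral, so along nested quarters it decays no faster than [4 ^ k]. The local
    hypothesis makes it smaller than that at the limit point. It is phrased with rectangles, not
    with a derivative, since the form need not be F(z) dz. *)
Lemma goursat (P Q : R -> R -> C) (x0 y0 w0 h0 : R) :
  0 < w0 -> 0 < h0 ->
  (forall x y, x0 <= x <= x0 + w0 -> y0 <= y <= y0 + h0 ->
     ccont (fun t => P t y) x /\ ccont (fun t => Q x t) y) ->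
  (forall xs ys eps, x0 <= xs <= x0 + w0 -> y0 <= ys <= y0 + h0 -> 0 < eps ->
     exists del, 0 < del /\ forall x y w h, 0 < w < del -> 0 < h < del ->
       x0 <= x -> x <= xs <= x + w -> x + w <= x0 + w0 ->
       y0 <= y -> y <= ys <= y + h -> y + h <= y0 + h0 ->
       Cmod (rect_int P Q x y w h) <= eps * (w + h) ^ 2) ->
  rect_int P Q x0 y0 w0 h0 = 0%C.
Proof.
  intros Hw0 Hh0 Hc Hloc.
  assert (HP : forall y u v, y0 <= y <= y0 + h0 -> x0 <= u -> u <= v -> v <= x0 + w0 ->
    ex_RInt (V := CV) (fun t => P t y) u v).
  { intros; apply ex_CInt; trivial; intros; apply (Hc t y); lra. }
  assert (HQ : forall x u v, x0 <= x <= x0 + w0 -> y0 <= u -> u <= v -> v <= y0 + h0 ->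
    ex_RInt (V := CV) (fun t => Q x t) u v).
  { intros; apply ex_CInt; trivial; intros; apply (Hc x t); lra. }
  assert (Hsplit : forall x y w h, 0 <= w -> 0 <= h -> x0 <= x -> x + 2 * w <= x0 + w0 ->
    y0 <= y -> y + 2 * h <= y0 + h0 ->
    rect_int P Q x y (2 * w) (2 * h)
    = (rect_int P Q x y w h + rect_int P Q (x + w) y w h
       + rect_int P Q x (y + h) w h + rect_int P Q (x + w) (y + h) w h)%C).
  { intros x y w h Hw Hh Hx Hxw Hy Hyh; unfold rect_int.
    replace (x + w + w) with (x + 2 * w) by ring.
    replace (y + h + h) with (y + 2 * h) by ring.
    rewrite <- (CInt_Chasles (fun t => P t y) x (x + w) (x + 2 * w)) by (apply HP; lra).
    rewrite <- (CInt_Chasles (fun t => P t (y + 2 * h)) x (x + w) (x + 2 * w)) by (apply HP; lra).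
    rewrite <- (CInt_Chasles (fun t => Q x t) y (y + h) (y + 2 * h)) by (apply HQ; lra).
    rewrite <- (CInt_Chasles (fun t => Q (x + 2 * w) t) y (y + h) (y + 2 * h)) by (apply HQ; lra).
    repeat match goal with |- context [RInt ?f ?u ?v] => generalize (RInt (V := CV) f u v); intro end.
    ring. }
  clear HP HQ.
  set (W k := w0 / 2 ^ k). set (V k := h0 / 2 ^ k).
  set (E k (z : R * R) := Cmod (rect_int P Q (fst z) (snd z) (W k) (V k))).
  (* The last quarter needs no test: if three of the four fall short of a quarter of the modulus,
     the triangle inequality forces the fourth to reach it. *)
  set (next k (z : R * R) :=
    let x := fst z in let y := snd z in let w := W (S k) in let h := V (S k) in
    let e := E k z / 4 in
    if Rle_dec e (E (S k) (x, y)) then (x, y)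
    else if Rle_dec e (E (S k) (x + w, y)) then (x + w, y)
    else if Rle_dec e (E (S k) (x, y + h)) then (x, y + h)
    else (x + w, y + h)).
  set (z := fix z k := match k with O => (x0, y0) | S k => next k (z k) end).
  assert (HWpos : forall k, 0 < W k /\ 0 < V k).
  { intros k; split; apply Rdiv_lt_0_compat; trivial; apply pow_lt; lra. }
  assert (HWS : forall k, W k = 2 * W (S k) /\ V k = 2 * V (S k)).
  { intros k; unfold W, V; simpl; split; field; apply pow_nonzero; lra. }
  assert (Hnext : forall k u, x0 <= fst u -> fst u + W k <= x0 + w0 ->
      y0 <= snd u -> snd u + V k <= y0 + h0 ->
      E k u / 4 <= E (S k) (next k u) /\
      fst u <= fst (next k u) /\ fst (next k u) + W (S k) <= fst u + W k /\
      snd u <= snd (next k u) /\ snd (next k u) + V (S k) <= snd u + V k).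
  { intros k [x y] Hx Hx' Hy Hy'; simpl in Hx, Hx', Hy, Hy'.
    destruct (HWpos (S k)) as [Hw Hv]; destruct (HWS k) as [HW HV].
    assert (Hsum : E k (x, y) <= E (S k) (x, y) + E (S k) (x + W (S k), y)
       + E (S k) (x, y + V (S k)) + E (S k) (x + W (S k), y + V (S k))).
    { unfold E; simpl fst; simpl snd; rewrite HW, HV, Hsplit by lra.
      eapply Rle_trans; [apply Cmod_triangle|]; apply Rplus_le_compat_r.
      eapply Rle_trans; [apply Cmod_triangle|]; apply Rplus_le_compat_r.
      apply Cmod_triangle. }
    unfold next; simpl fst; simpl snd; cbv zeta.
    clear - Hx Hx' Hy Hy' Hw Hv HW HV Hsum.
    repeat (destruct Rle_dec as [?|?]; [simpl fst; simpl snd; repeat split; lra|]).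
    simpl fst; simpl snd; repeat split; lra. }
  assert (Hz : forall k, x0 <= fst (z k) /\ fst (z k) + W k <= x0 + w0 /\
      y0 <= snd (z k) /\ snd (z k) + V k <= y0 + h0).
  { induction k as [|k IH].
    - simpl; unfold W, V; simpl; lra.
    - destruct IH as (H1 & H2 & H3 & H4).
      destruct (Hnext k (z k) H1 H2 H3 H4) as (_ & ? & ? & ? & ?).
      simpl; lra. }
  assert (Hstep : forall k, E k (z k) / 4 <= E (S k) (z (S k)) /\
      fst (z k) <= fst (z (S k)) /\ fst (z (S k)) + W (S k) <= fst (z k) + W k /\
      snd (z k) <= snd (z (S k)) /\ snd (z (S k)) + V (S k) <= snd (z k) + V k).
  { intros k; destruct (Hz k) as (H1 & H2 & H3 & H4); exact (Hnext k (z k) H1 H2 H3 H4). }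
  assert (Hlow : forall k, E 0%nat (z 0%nat) / 4 ^ k <= E k (z k)).
  { induction k as [|k IH]; [simpl; lra|].
    eapply Rle_trans; [|apply (Hstep k)].
    replace (E 0%nat (z 0%nat) / 4 ^ S k) with (E 0%nat (z 0%nat) / 4 ^ k / 4); [lra|].
    simpl; field; apply pow_nonzero; lra. }
  destruct (nested_intervals (fun k => fst (z k)) (fun k => fst (z k) + W k)) as [xs Hxs];
    try (intros k; destruct (Hstep k); destruct (HWpos k); lra).
  destruct (nested_intervals (fun k => snd (z k)) (fun k => snd (z k) + V k)) as [ys Hys];
    try (intros k; destruct (Hstep k); destruct (HWpos k); lra).
  apply Cmod_eq_0.
  assert (HE0 : E 0%nat (z 0%nat) = Cmod (rect_int P Q x0 y0 w0 h0)).
  { unfold E, W, V; simpl; rewrite !Rdiv_1_r; reflexivity. }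
  rewrite <- HE0.
  destruct (Rle_lt_or_eq_dec 0 (E 0%nat (z 0%nat)) (Cmod_ge_0 _)) as [Hpos|]; [exfalso|congruence].
  set (e := E 0%nat (z 0%nat)) in *.
  (* Since [W k + V k] is [(w0 + h0) / 2 ^ k], this tolerance turns the local bound into half of the
     lower bound [e / 4 ^ k]. *)
  destruct (Hloc xs ys (e / (2 * (w0 + h0) ^ 2))) as [del [Hdel Hsmall]].
  { specialize (Hxs 0%nat); specialize (Hz 0%nat); lra. }
  { specialize (Hys 0%nat); specialize (Hz 0%nat); lra. }
  { apply Rdiv_lt_0_compat; trivial; apply Rmult_lt_0_compat; [lra|apply pow_lt; lra]. }
  destruct (pow_lt_1_zero (/ 2)) with (y := del / (w0 + h0)) as [k Hk].
  { rewrite Rabs_pos_eq; lra. }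
  { apply Rdiv_lt_0_compat; lra. }
  specialize (Hk k (le_n k)).
  assert (Hp2 : 0 < 2 ^ k) by (apply pow_lt; lra).
  rewrite pow_inv, Rabs_pos_eq in Hk by (left; apply Rinv_0_lt_compat, Hp2).
  apply (Rmult_lt_compat_r (w0 + h0)) in Hk; [|lra].
  replace (del / (w0 + h0) * (w0 + h0)) with del in Hk by (field; lra).
  assert (HWV : W k + V k < del) by (unfold W, V; lra).
  destruct (HWpos k) as [HWk HVk]; destruct (Hz k) as (? & ? & ? & ?).
  specialize (Hxs k); specialize (Hys k); specialize (Hlow k).
  assert (Hup : E k (z k) <= e / (2 * (w0 + h0) ^ 2) * (W k + V k) ^ 2)
    by (apply Hsmall; lra).
  replace (e / (2 * (w0 + h0) ^ 2) * (W k + V k) ^ 2) with (e / 4 ^ k / 2) in Hup.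
  - assert (0 < e / 4 ^ k) by (apply Rdiv_lt_0_compat; trivial; apply pow_lt; lra). lra.
  - unfold W, V. replace 4 with (2 * 2) by ring. rewrite Rpow_mult_distr.
    field; lra.
Qed.

(** * Cauchy's integral formula on a circle *)

(** Complex differentiability in remainder form, measured with [Cmod]: Goursat's estimate consumes
    precisely the remainder after an affine function. *)
Definition cdiff (F : C -> C) (z : C) : Prop :=
  exists l : C, forall eps, 0 < eps -> exists del, 0 < del /\ forall w, Cmod (w - z) < del ->
    Cmod (F w - F z - l * (w - z)) <= eps * Cmod (w - z).

Lemma holo_at_cdiff (F : C -> C) (z : C) : holo_at F z -> cdiff F z.
Proof.
  intros [l [_ Hl]]; exists l; intros eps Heps.
  specialize (Hl z (fun P HP => HP) (mkposreal eps Heps)).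
  destruct Hl as [del Hdel]; exists del; split; [apply cond_pos|].
  intros w Hw; specialize (Hdel w Hw).
  change (norm (V := C_NormedModule) (F w - F z - (w - z) * l)%C <= eps * Cmod (w - z)) in Hdel.
  change (Cmod (F w - F z - (w - z) * l) <= eps * Cmod (w - z)) in Hdel.
  rewrite (Cmult_comm l); exact Hdel.
Qed.

Lemma continuous_C_of (F : C -> C) (z : C) :
  (forall eps, 0 < eps -> exists del, 0 < del /\ forall w, Cmod (w - z) < del ->
    Cmod (F w - F z) < eps) ->
  continuous (T := C_UniformSpace) (U := C_UniformSpace) F z.
Proof.
  intros H P [e He]; destruct (H e (cond_pos e)) as [d [Hd Hw]].
  assert (Hs : 0 < sqrt 2) by (apply sqrt_lt_R0; lra).
  (* Balls of [C_UniformSpace] are squares; the factor [sqrt 2] fits one into the disc of radius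
     [d]. *)
  assert (Hd' : 0 < d / sqrt 2) by (apply Rdiv_lt_0_compat; trivial).
  exists (mkposreal _ Hd'); intros w Hb.
  apply He, C_NormedModule_mixin_compat1, Hw.
  pose proof (C_NormedModule_mixin_compat2 z w _ Hb) as Hc; simpl in Hc.
  replace (sqrt 2 * (d / sqrt 2)) with d in Hc by (field; lra); exact Hc.
Qed.

Lemma cdiff_eps (F : C -> C) (z : C) : cdiff F z ->
  forall eps, 0 < eps -> exists del, 0 < del /\ forall w, Cmod (w - z) < del ->
    Cmod (F w - F z) < eps.
Proof.
  intros [l Hl] eps Heps.
  destruct (Hl 1 Rlt_0_1) as [d [Hd Hw]].
  pose proof (Cmod_ge_0 l) as Hl0.
  exists (Rmin d (eps / (2 + Cmod l))); split.
  { apply Rmin_pos; trivial; apply Rdiv_lt_0_compat; lra. }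
  intros w Hwz.
  assert (H1 : Cmod (w - z) < d) by (eapply Rlt_le_trans; [exact Hwz|apply Rmin_l]).
  assert (H2 : Cmod (w - z) < eps / (2 + Cmod l)) by (eapply Rlt_le_trans; [exact Hwz|apply Rmin_r]).
  specialize (Hw w H1).
  apply (Rmult_lt_compat_r (2 + Cmod l)) in H2; [|lra].
  replace (eps / (2 + Cmod l) * (2 + Cmod l)) with eps in H2 by (field; lra).
  replace (F w - F z)%C with ((F w - F z - l * (w - z)) + l * (w - z))%C by ring.
  eapply Rle_lt_trans; [apply Cmod_triangle|]; rewrite Cmod_mult.
  pose proof (Cmod_ge_0 (w - z)); nra.
Qed.

Lemma cdiff_continuous (F : C -> C) (z : C) :
  cdiff F z -> continuous (T := C_UniformSpace) (U := C_UniformSpace) F z.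
Proof. intros H; apply continuous_C_of, cdiff_eps, H. Qed.

Definition cis (t : R) : C := (cos t, sin t).

Lemma Cmod_cis (t : R) : Cmod (cis t) = 1.
Proof.
  unfold Cmod, cis; simpl.
  replace (cos t * (cos t * 1) + sin t * (sin t * 1)) with (Rsqr (sin t) + Rsqr (cos t))
    by (unfold Rsqr; ring).
  rewrite sin2_cos2; apply sqrt_1.
Qed.

Lemma continuous_cis (t : R) : ccont cis t.
Proof.
  apply (continuous_pair (V := R_UniformSpace) (W := R_UniformSpace));
  apply (ex_derive_continuous (K := R_AbsRing) (V := R_NormedModule)); auto_derive; trivial.
Qed.

Lemma is_CInt_plus (f g : R -> C) (a b : R) (l m : C) :
  is_RInt (V := CV) f a b l -> is_RInt (V := CV) g a b m ->
  is_RInt (V := CV) (fun t => (f t + g t)%C) a b (l + m)%C.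
Proof. exact (is_RInt_plus (V := CV) f g a b l m). Qed.

Lemma is_CInt_minus (f g : R -> C) (a b : R) (l m : C) :
  is_RInt (V := CV) f a b l -> is_RInt (V := CV) g a b m ->
  is_RInt (V := CV) (fun t => (f t - g t)%C) a b (l - m)%C.
Proof. exact (is_RInt_minus (V := CV) f g a b l m). Qed.

Lemma is_CInt_const (c : C) (a b : R) : is_RInt (V := CV) (fun _ => c) a b (RtoC (b - a) * c)%C.
Proof.
  replace (RtoC (b - a) * c)%C with (scal (V := CV) (b - a) c).
  - apply (is_RInt_const (V := CV)).
  - destruct c as [u v]; unfold Cmult, scal; simpl; unfold prod_scal, scal; simpl.
    unfold mult; simpl. apply injective_projections; simpl; ring.
Qed.

Lemma is_RInt_R_of_derive (f df : R -> R) (a b : R) :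
  (forall t, is_derive f t (df t)) -> (forall t, continuous df t) ->
  is_RInt df a b (f b - f a).
Proof. intros; apply (is_RInt_derive f df); intros; trivial. Qed.

Lemma is_CInt_cis (a b : R) : is_RInt (V := CV) (fun t => (Ci * cis t)%C) a b (cis b - cis a)%C.
Proof.
  apply (is_RInt_fct_extend_pair (U := R_NormedModule) (V := R_NormedModule)
    (fun t => (Ci * cis t)%C) a b (cos b - cos a) (sin b - sin a)); simpl.
  - apply (is_RInt_ext (V := R_NormedModule) (fun t => - sin t)); [intros; simpl; change (@eq R (- sin x) (0 * cos x - 1 * sin x)); ring|].
    apply (is_RInt_R_of_derive cos); intros t; [auto_derive; trivial; ring|].
    apply (ex_derive_continuous (K := R_AbsRing) (V := R_NormedModule)); auto_derive; trivial.
  - apply (is_RInt_ext (V := R_NormedModule) cos); [intros; change (@eq R (cos x) (0 * sin x + 1 * cos x)); ring|].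
    apply (is_RInt_R_of_derive sin); intros t; [auto_derive; trivial; ring|].
    apply (ex_derive_continuous (K := R_AbsRing) (V := R_NormedModule)); auto_derive; trivial.
Qed.

Lemma rect_int_minus (P Q P' Q' : R -> R -> C) (x y w h : R) :
  ex_RInt (V := CV) (fun t => P t y) x (x + w) ->
  ex_RInt (V := CV) (fun t => P t (y + h)) x (x + w) ->
  ex_RInt (V := CV) (fun t => Q x t) y (y + h) ->
  ex_RInt (V := CV) (fun t => Q (x + w) t) y (y + h) ->
  ex_RInt (V := CV) (fun t => P' t y) x (x + w) ->
  ex_RInt (V := CV) (fun t => P' t (y + h)) x (x + w) ->
  ex_RInt (V := CV) (fun t => Q' x t) y (y + h) ->
  ex_RInt (V := CV) (fun t => Q' (x + w) t) y (y + h) ->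
  rect_int (fun t s => P t s - P' t s)%C (fun t s => Q t s - Q' t s)%C x y w h
  = (rect_int P Q x y w h - rect_int P' Q' x y w h)%C.
Proof.
  intros; unfold rect_int.
  assert (HM : forall f g u v, ex_RInt (V := CV) f u v -> ex_RInt (V := CV) g u v ->
    RInt (V := CV) (fun t => (f t - g t)%C) u v
    = (RInt (V := CV) (fun t => f t) u v - RInt (V := CV) (fun t => g t) u v)%C).
  { intros; apply is_RInt_unique, is_CInt_minus; apply (RInt_correct (V := CV)); trivial. }
  rewrite 4!HM by trivial. cbv beta. ring.
Qed.

Lemma rect_int_bound (P Q : R -> R -> C) (x y w h M : R) :
  0 <= w -> 0 <= h ->
  ex_RInt (V := CV) (fun t => P t y) x (x + w) ->
  ex_RInt (V := CV) (fun t => P t (y + h)) x (x + w) ->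
  ex_RInt (V := CV) (fun t => Q x t) y (y + h) ->
  ex_RInt (V := CV) (fun t => Q (x + w) t) y (y + h) ->
  (forall t s, x <= t <= x + w -> y <= s <= y + h -> Cmod (P t s) <= M /\ Cmod (Q t s) <= M) ->
  Cmod (rect_int P Q x y w h) <= 2 * (w + h) * M.
Proof.
  intros Hw Hh H1 H2 H3 H4 HM; unfold rect_int, Cminus.
  assert (HB1 : Cmod (RInt (V := CV) (fun t => P t y) x (x + w)) <= w * M).
  { replace w with (x + w - x) at 2 by ring. apply CInt_bound; trivial; try lra; intros; apply HM; lra. }
  assert (HB2 : Cmod (RInt (V := CV) (fun t => P t (y + h)) x (x + w)) <= w * M).
  { replace w with (x + w - x) at 2 by ring. apply CInt_bound; trivial; try lra; intros; apply HM; lra. }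
  assert (HB3 : Cmod (RInt (V := CV) (fun t => Q x t) y (y + h)) <= h * M).
  { replace h with (y + h - y) at 2 by ring. apply CInt_bound; trivial; try lra; intros; apply HM; lra. }
  assert (HB4 : Cmod (RInt (V := CV) (fun t => Q (x + w) t) y (y + h)) <= h * M).
  { replace h with (y + h - y) at 2 by ring. apply CInt_bound; trivial; try lra; intros; apply HM; lra. }
  eapply Rle_trans; [apply Cmod_triangle|]; rewrite Cmod_opp.
  eapply Rle_trans; [apply Rplus_le_compat_r, Cmod_triangle|]; rewrite Cmod_opp.
  eapply Rle_trans; [apply Rplus_le_compat_r, Rplus_le_compat_r, Cmod_triangle|].
  lra.
Qed.

Lemma Cmod_cis_sub (s t : R) : Cmod (cis s - cis t) <= 2 * Rabs (s - t).
Proof.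
  assert (Hle : forall u v, u <= v -> Cmod (cis v - cis u) <= v - u).
  { intros u v Huv. rewrite <- (is_RInt_unique (V := CV) _ _ _ _ (is_CInt_cis u v)).
    rewrite <- (Rmult_1_r (v - u)). apply CInt_bound; trivial.
    - eexists; apply is_CInt_cis.
    - intros; rewrite Cmod_mult, Cmod_Ci, Cmod_cis; lra. }
  destruct (Rle_dec t s) as [H|H].
  - rewrite Rabs_pos_eq by lra. specialize (Hle t s H); lra.
  - rewrite Rabs_left by lra. specialize (Hle s t ltac:(lra)).
    replace (cis s - cis t)%C with (- (cis t - cis s))%C by ring. rewrite Cmod_opp; lra.
Qed.

Lemma Cmod_minus_ge (x y : C) : Cmod x - Cmod y <= Cmod (x - y).
Proof.
  pose proof (Cmod_triangle (x - y) y) as H.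
  replace (x - y + y)%C with x in H by ring; lra.
Qed.

Lemma Cmod_minus_le (x y : C) : Cmod (x - y) <= Cmod x + Cmod y.
Proof. unfold Cminus; rewrite <- (Cmod_opp y); apply Cmod_triangle. Qed.

(* The paths [zeta + t (rho e^(i theta) - zeta)], 0 < t <= 1, contract the circle to [zeta];
   in the coordinates (t, theta) the form F(z) dz / (z - zeta) becomes
   F (dt / t + k dtheta), with [k] as below. *)
Lemma circle_kernel_integral (F : C -> C) (r rho : R) (zeta : C) :
  rho < r -> Cmod zeta < rho -> (forall z, Cmod z < r -> cdiff F z) ->
  let k th := (rho * (Ci * cis th) / (rho * cis th - zeta))%C in
  RInt (V := CV) (fun th => (F (rho * cis th) * k th)%C) 0 (2 * PI)
  = (F zeta * RInt (V := CV) k 0 (2 * PI))%C.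
Proof.
  intros Hrho Hzeta HF k.
  pose proof (Cmod_ge_0 zeta) as Hz0. pose proof PI_RGT_0 as HPI.
  set (p th := (rho * cis th - zeta)%C).
  assert (Hrc : forall th, Cmod (rho * cis th) = rho).
  { intros; rewrite Cmod_mult, Cmod_R, Cmod_cis, Rabs_pos_eq; lra. }
  assert (Hp1 : forall th, rho - Cmod zeta <= Cmod (p th)).
  { intros th; rewrite <- (Hrc th) at 1; apply Cmod_minus_ge. }
  assert (Hp0 : forall th, p th <> 0%C).
  { intros th; apply Cmod_gt_0; specialize (Hp1 th); lra. }
  assert (Hp2 : forall th, Cmod (p th) <= 2 * rho).
  { intros th; eapply Rle_trans; [apply Cmod_minus_le|]; rewrite Hrc; lra. }
  set (K := rho / (rho - Cmod zeta)).
  assert (HK : 0 < K) by (apply Rdiv_lt_0_compat; lra).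
  assert (Hk : forall th, Cmod (k th) <= K).
  { intros th; unfold k. rewrite Cmod_div by apply Hp0.
    rewrite !Cmod_mult, Cmod_R, Cmod_Ci, Cmod_cis, Rabs_pos_eq by lra.
    unfold K, Rdiv; rewrite !Rmult_1_r. apply Rmult_le_compat_l; [lra|].
    apply Rinv_le_contravar; [lra|apply Hp1]. }
  assert (Hcp : forall th, ccont p th).
  { intros th; apply continuous_Cplus; [|apply continuous_const].
    apply continuous_Cmult; [apply continuous_const|apply continuous_cis]. }
  assert (Hck : forall th, ccont k th).
  { intros th; apply continuous_Cmult.
    - apply continuous_Cmult; [apply continuous_const|].
      apply continuous_Cmult; [apply continuous_const|apply continuous_cis].
    - apply (continuous_Cinv p); [apply Hcp|apply Hp0]. }
  set (Z t th := (zeta + RtoC t * p th)%C).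
  assert (HZ : forall t th, 0 <= t <= 1 -> Cmod (Z t th) < r).
  { intros t th Ht. unfold Z, p.
    replace (zeta + t * (rho * cis th - zeta))%C
      with (RtoC (1 - t) * zeta + RtoC t * (rho * cis th))%C by (rewrite RtoC_minus; ring).
    eapply Rle_lt_trans; [apply Cmod_triangle|].
    rewrite Cmod_mult, (Cmod_mult t), Hrc, !Cmod_R, !Rabs_pos_eq by lra.
    nra. }
  assert (HFZ : forall t th, 0 <= t <= 1 ->
    continuous (T := C_UniformSpace) (U := C_UniformSpace) F (Z t th)).
  { intros; apply cdiff_continuous, HF, HZ; trivial. }
  assert (HFt : forall t th, 0 <= t <= 1 -> ccont (fun u => F (Z u th)) t).
  { intros t th Ht; apply (continuous_comp (fun u => Z u th) F); [|apply HFZ, Ht].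
    apply continuous_Cplus; [apply continuous_const|].
    apply continuous_Cmult; [apply continuous_RtoC, continuous_id|apply continuous_const]. }
  assert (HFth : forall t th, 0 <= t <= 1 -> ccont (fun u => F (Z t u)) th).
  { intros t th Ht; apply (continuous_comp (fun u => Z t u) F); [|apply HFZ, Ht].
    apply continuous_Cplus; [apply continuous_const|].
    apply continuous_Cmult; [apply continuous_const|apply Hcp]. }
  set (P t th := (F (Z t th) * / RtoC t)%C).
  set (Q t th := (F (Z t th) * k th)%C).
  assert (HPc : forall t th, 0 < t <= 1 -> ccont (fun u => P u th) t).
  { intros t th Ht; apply continuous_Cmult; [apply HFt; lra|].
    apply continuous_Cinv; [apply continuous_RtoC, continuous_id|].
    intros H; apply RtoC_inj in H; lra. }
  assert (HQc : forall t th, 0 <= t <= 1 -> ccont (fun u => Q t u) th).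
  { intros t th Ht; apply continuous_Cmult; [apply HFth; lra|apply Hck]. }
  assert (HPi : forall th u v, 0 < u -> u <= v -> v <= 1 -> ex_RInt (V := CV) (fun t => P t th) u v).
  { intros; apply ex_CInt; trivial; intros; apply HPc; lra. }
  assert (HQi : forall t u v, 0 <= t <= 1 -> u <= v -> ex_RInt (V := CV) (fun th => Q t th) u v).
  { intros; apply ex_CInt; trivial; intros; apply HQc; lra. }
  (* The integral over the contracted circle does not depend on the contraction parameter. The value
     t = 0, where dt / t is singular, is reached only as a limit. *)
  assert (Hconst : forall t0, 0 < t0 < 1 ->
    RInt (V := CV) (fun th => Q 1 th) 0 (2 * PI) = RInt (V := CV) (fun th => Q t0 th) 0 (2 * PI)).
  { intros t0 Ht0.
    assert (HG : rect_int P Q t0 0 (1 - t0) (2 * PI) = 0%C).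
    { apply goursat; try lra.
      - intros t th Ht Hth; split; [apply HPc|apply HQc]; lra.
      - intros ts ths eps Hts Hths Heps.
        destruct (HF (Z ts ths) ltac:(apply HZ; lra)) as [l Hl].
        set (KK := K + / t0).
        assert (Hit0 : 0 < / t0) by (apply Rinv_0_lt_compat; lra).
        (* On a small rectangle [Z] varies by at most [2 * rho * (w + h)], [KK] bounds both 1/t and
           [k], and the perimeter is [2 * (w + h)]; the product of these with the tolerance is
           [eps * (w + h) ^ 2]. *)
        destruct (Hl (eps / (4 * rho * KK))) as [del [Hdel Hrem]].
        { apply Rdiv_lt_0_compat; trivial. unfold KK; nra. }
        exists (del / (4 * rho)); split; [apply Rdiv_lt_0_compat; lra|].
        intros x y w h Hw Hh Hx1 Hx2 Hx3 Hy1 Hy2 Hy3.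
        (* The affine part of [F] at [Z ts ths] is al + l (z - zeta). It turns the form into al
           (dt/t + k dtheta) + l dz, whose coefficients are [P'] and [Q']; this form is closed, so
           its boundary integral vanishes and only the remainder of [F] counts. *)
        set (al := (F (Z ts ths) + l * (zeta - Z ts ths))%C).
        set (P' t th := (al * / RtoC t + l * p th)%C).
        set (Q' t th := (al * k th + l * RtoC t * (rho * (Ci * cis th)))%C).
        assert (Hinv : ex_RInt (V := CV) (fun t => / RtoC t)%C x (x + w)).
        { apply ex_CInt; [lra|]. intros t Ht.
          apply continuous_Cinv; [apply continuous_RtoC, continuous_id|].
          intros H; apply RtoC_inj in H; lra. }
        assert (Hki : ex_RInt (V := CV) k y (y + h)).
        { apply ex_CInt; [lra|]; intros; apply Hck. }
        assert (HP' : forall th, is_RInt (V := CV) (fun t => P' t th) x (x + w)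
           (al * RInt (V := CV) (fun t => / RtoC t)%C x (x + w) + RtoC (x + w - x) * (l * p th))%C).
        { intros th; apply is_CInt_plus; [apply is_CInt_mult_l, (RInt_correct (V := CV)), Hinv|].
          apply is_CInt_const. }
        assert (HQ' : forall t, is_RInt (V := CV) (fun th => Q' t th) y (y + h)
           (al * RInt (V := CV) k y (y + h) + l * RtoC t * (rho * (cis (y + h) - cis y)))%C).
        { intros t; apply is_CInt_plus; apply is_CInt_mult_l; [apply (RInt_correct (V := CV)), Hki|].
          apply is_CInt_mult_l, is_CInt_cis. }
        assert (H0 : rect_int P' Q' x y w h = 0%C).
        { unfold rect_int.
          rewrite (is_RInt_unique (V := CV) _ _ _ _ (HP' y)), (is_RInt_unique (V := CV) _ _ _ _ (HP' (y + h))),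
            (is_RInt_unique (V := CV) _ _ _ _ (HQ' x)), (is_RInt_unique (V := CV) _ _ _ _ (HQ' (x + w))).
          unfold p; rewrite RtoC_minus, RtoC_plus; ring. }
        replace (rect_int P Q x y w h) with (rect_int P Q x y w h - rect_int P' Q' x y w h)%C
          by (rewrite H0; ring).
        rewrite <- rect_int_minus;
          [|apply HPi; lra|apply HPi; lra|apply HQi; lra|apply HQi; lra
           |eexists; apply HP'|eexists; apply HP'|eexists; apply HQ'|eexists; apply HQ'].
        assert (Hdw : 2 * rho * (w + h) < del).
        { assert (w + h < 2 * (del / (4 * rho))) by lra.
          apply (Rmult_lt_compat_l (2 * rho)) in H; [|lra].
          replace (2 * rho * (2 * (del / (4 * rho)))) with del in H by (field; lra); lra. }
        eapply Rle_trans; [apply rect_int_bound with (M := eps / 2 * (w + h)); try lra|nra].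
        1,2: eapply (ex_RInt_minus (V := CV)); [apply HPi; lra|eexists; apply HP'].
        1,2: eapply (ex_RInt_minus (V := CV)); [apply HQi; lra|eexists; apply HQ'].
        intros t th Ht Hth.
        assert (Hzz : Cmod (Z t th - Z ts ths) <= 2 * rho * (w + h)).
        { replace (Z t th - Z ts ths)%C with
            (RtoC (t - ts) * p th + RtoC ts * (RtoC rho * (cis th - cis ths)))%C
            by (unfold Z, p; rewrite RtoC_minus; ring).
          eapply Rle_trans; [apply Cmod_triangle|]; rewrite !Cmod_mult, !Cmod_R.
          pose proof (Cmod_cis_sub th ths) as Hcis.
          assert (Rabs (t - ts) <= w) by (apply Rabs_le; lra).
          assert (Rabs (th - ths) <= h) by (apply Rabs_le; lra).
          rewrite (Rabs_pos_eq ts), (Rabs_pos_eq rho) by lra.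
          specialize (Hp2 th).
          assert (Rabs (t - ts) * Cmod (p th) <= w * (2 * rho))
            by (apply Rmult_le_compat; trivial; [apply Rabs_pos|apply Cmod_ge_0]).
          assert (rho * Cmod (cis th - cis ths) <= rho * (2 * h)) by (apply Rmult_le_compat_l; lra).
          assert (0 <= rho * Cmod (cis th - cis ths)) by (apply Rmult_le_pos; [lra|apply Cmod_ge_0]).
          nra. }
        assert (Hr : Cmod (F (Z t th) - F (Z ts ths) - l * (Z t th - Z ts ths))
          <= eps / (2 * KK) * (w + h)).
        { eapply Rle_trans; [apply Hrem; lra|].
          replace (eps / (2 * KK) * (w + h)) with (eps / (4 * rho * KK) * (2 * rho * (w + h)))
            by (field; split; unfold KK; lra).
          apply Rmult_le_compat_l; trivial.
          left; apply Rdiv_lt_0_compat; trivial; unfold KK; nra. }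
        set (rem := (F (Z t th) - F (Z ts ths) - l * (Z t th - Z ts ths))%C) in *.
        assert (Hfin : forall c, Cmod c <= KK -> Cmod (rem * c) <= eps / 2 * (w + h)).
        { intros c Hc; rewrite Cmod_mult.
          replace (eps / 2 * (w + h)) with (eps / (2 * KK) * (w + h) * KK)
            by (field; unfold KK; lra).
          apply Rmult_le_compat; trivial; apply Cmod_ge_0. }
        split.
        + replace (P t th - P' t th)%C with (rem * / RtoC t)%C.
          * apply Hfin. rewrite Cmod_inv by (intros H; apply RtoC_inj in H; lra).
            rewrite Cmod_R, Rabs_pos_eq by lra. unfold KK.
            assert (/ t <= / t0) by (apply Rinv_le_contravar; lra). lra.
          * unfold rem, P, P', al, Z; field. intros H; apply RtoC_inj in H; lra.
        + replace (Q t th - Q' t th)%C with (rem * k th)%C.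
          * apply Hfin. specialize (Hk th). unfold KK; lra.
          * unfold rem, Q, Q', al, Z, k; fold (p th). field. apply Hp0. }
    unfold rect_int in HG.
    replace (t0 + (1 - t0)) with 1 in HG by ring. rewrite Rplus_0_l in HG.
    (* The sides theta = 0 and theta = 2 pi describe the same segment and cancel. *)
    replace (RInt (V := CV) (fun t => P t (2 * PI)) t0 1)
      with (RInt (V := CV) (fun t => P t 0) t0 1) in HG.
    - assert (Haux : forall A B D : C, (A + B - A - D)%C = 0%C -> B = D).
      { intros A B D H; replace B with ((A + B - A - D) + D)%C by ring; rewrite H; ring. }
      exact (Haux _ _ _ HG).
    - apply (RInt_ext (V := CV)); intros t _; unfold P, Z, p, cis.
      rewrite cos_2PI, sin_2PI, cos_0, sin_0; reflexivity. }
  assert (Hkint : ex_RInt (V := CV) k 0 (2 * PI)).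
  { apply ex_CInt; [lra|]; intros; apply Hck. }
  rewrite <- (CInt_mult_l (F zeta) k) by exact Hkint.
  set (D := (RInt (V := CV) (fun th => Q 1 th) 0 (2 * PI)
             - RInt (V := CV) (fun th => F zeta * k th)%C 0 (2 * PI))%C).
  assert (HD : D = 0%C).
  { apply Cmod_eq_0.
    destruct (Rle_lt_or_eq_dec 0 (Cmod D) (Cmod_ge_0 _)) as [Hpos|]; [exfalso|congruence].
    (* On a circle contracted so far that [F] is within [e] of [F zeta], the difference of the
       integrals is at most [2 * PI * (e * K)], that is [Cmod D / 2]. *)
    set (e := Cmod D / (4 * PI * K)).
    assert (He : 0 < e) by (apply Rdiv_lt_0_compat; trivial; nra).
    destruct (cdiff_eps F zeta (HF zeta ltac:(lra)) e He) as [del [Hdel Hw]].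
    set (t0 := Rmin (/ 2) (del / (4 * rho))).
    assert (Ht0 : 0 < t0 < 1).
    { split; [apply Rmin_pos; [lra|apply Rdiv_lt_0_compat; lra]|].
      eapply Rle_lt_trans; [apply Rmin_l|lra]. }
    assert (Ht1 : t0 * (2 * rho) < del).
    { assert (t0 <= del / (4 * rho)) by apply Rmin_r.
      apply (Rmult_le_compat_r (2 * rho)) in H; [|lra].
      replace (del / (4 * rho) * (2 * rho)) with (del / 2) in H by (field; lra); lra. }
    assert (HDb : Cmod D <= (2 * PI - 0) * (e * K)).
    { unfold D; rewrite (Hconst t0 Ht0).
      rewrite <- (is_RInt_unique (V := CV) _ _ _ _
        (is_CInt_minus _ _ _ _ _ _
          (RInt_correct (V := CV) _ _ _ (HQi t0 0 (2 * PI) ltac:(lra) ltac:(lra)))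
          (RInt_correct (V := CV) _ _ _ (ex_intro _ _ (is_CInt_mult_l (F zeta) _ _ _ _ (RInt_correct (V := CV) _ _ _ Hkint)))))).
      apply CInt_bound; [lra| |].
      - eapply (ex_RInt_minus (V := CV)); [apply HQi; lra|].
        eexists; apply is_CInt_mult_l, (RInt_correct (V := CV)), Hkint.
      - intros th _. replace (Q t0 th - F zeta * k th)%C with ((F (Z t0 th) - F zeta) * k th)%C
          by (unfold Q; ring).
        rewrite Cmod_mult. apply Rmult_le_compat; try apply Cmod_ge_0; [|apply Hk].
        left; apply Hw. replace (Z t0 th - zeta)%C with (RtoC t0 * p th)%C by (unfold Z; ring).
        rewrite Cmod_mult, Cmod_R, Rabs_pos_eq by lra. specialize (Hp2 th). nra. }
    replace ((2 * PI - 0) * (e * K)) with (Cmod D / 2) in HDb; [lra|].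
    unfold e; field; lra. }
  transitivity (RInt (V := CV) (fun th => Q 1 th) 0 (2 * PI)).
  - apply (RInt_ext (V := CV)); intros th _. unfold Q, Z, p. f_equal. f_equal. ring.
  - assert (Haux : forall A B : C, (A - B)%C = 0%C -> A = B).
    { intros A B H; replace A with ((A - B) + B)%C by ring; rewrite H; ring. }
    exact (Haux _ _ HD).
Qed.

(** * Taylor expansions *)

Lemma Csum_S (n : nat) (u : nat -> C) : Csum (S n) u = (Csum n u + u n)%C.
Proof.
  unfold Csum; rewrite seq_S, map_app, fold_right_app; simpl.
  generalize (map u (seq 0 n)) as l; intros l; induction l as [|x l IH]; simpl.
  - ring.
  - rewrite IH; ring.
Qed.

Lemma Csum_S_l (n : nat) (u : nat -> C) : Csum (S n) u = (u 0%nat + Csum n (fun k => u (S k)))%C.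
Proof. unfold Csum; simpl; rewrite <- seq_shift, map_map; reflexivity. Qed.

Lemma Csum_ext (n : nat) (u v : nat -> C) :
  (forall k, (k < n)%nat -> u k = v k) -> Csum n u = Csum n v.
Proof.
  induction n as [|n IH]; intros H; [reflexivity|].
  rewrite !Csum_S, H, IH by auto with arith; reflexivity.
Qed.

Lemma Csum_plus (n : nat) (u v : nat -> C) :
  Csum n (fun k => u k + v k)%C = (Csum n u + Csum n v)%C.
Proof. induction n as [|n IH]; [unfold Csum; simpl; ring|]; rewrite !Csum_S, IH; ring. Qed.

Lemma Csum_mult_l (n : nat) (c : C) (u : nat -> C) :
  Csum n (fun k => c * u k)%C = (c * Csum n u)%C.
Proof. induction n as [|n IH]; [unfold Csum; simpl; ring|]; rewrite !Csum_S, IH; ring. Qed.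

Lemma is_CInt_Csum (n : nat) (f : nat -> R -> C) (l : nat -> C) (a b : R) :
  (forall k, is_RInt (V := CV) (f k) a b (l k)) ->
  is_RInt (V := CV) (fun t => Csum n (fun k => f k t)) a b (Csum n l).
Proof.
  intros H; induction n as [|n IH].
  - replace (Csum 0 l) with (RtoC (b - a) * 0)%C by (unfold Csum; simpl; ring).
    apply is_CInt_const.
  - rewrite Csum_S. apply (is_RInt_ext (V := CV) (fun t => Csum n (fun k => f k t) + f n t)%C).
    + intros; symmetry; apply Csum_S.
    + apply is_CInt_plus; trivial.
Qed.

Lemma div_lt_1 (x y : R) : 0 < y -> x < y -> x / y < 1.
Proof.
  intros Hy Hxy; apply (Rmult_lt_reg_r y); trivial.
  replace (x / y * y) with x by (field; lra); lra.
Qed.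

Lemma geometric_remainder (u : C) (n : nat) : u <> 1%C ->
  (/ (1 - u) - Csum n (fun k => u ^ k) = u ^ n * / (1 - u))%C.
Proof.
  intros Hu.
  assert (H1 : (1 - u)%C <> 0%C).
  { intros H; apply Hu. replace u with (1 - (1 - u))%C by ring. rewrite H; ring. }
  induction n as [|n IH]; [unfold Csum; simpl; field; exact H1|].
  rewrite Csum_S. replace (/ (1 - u) - (Csum n (fun k => u ^ k) + u ^ n))%C
    with (/ (1 - u) - Csum n (fun k => u ^ k) - u ^ n)%C by ring.
  rewrite IH; simpl; field; exact H1.
Qed.

Lemma le_geometric_eq_0 (x B q : R) : 0 <= q < 1 -> 0 <= x ->
  (forall n : nat, x <= B * q ^ n) -> x = 0.
Proof.
  intros Hq Hx H.
  destruct (Rle_lt_or_eq_dec 0 x Hx) as [Hpos|]; [exfalso|congruence].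
  assert (HB : 0 < B) by (specialize (H 0%nat); simpl in H; lra).
  destruct (pow_lt_1_zero q) with (y := x / (2 * B)) as [n Hn].
  - rewrite Rabs_pos_eq; lra.
  - apply Rdiv_lt_0_compat; lra.
  - specialize (Hn n (le_n n)); specialize (H n).
    rewrite Rabs_pos_eq in Hn by (apply pow_le; lra).
    apply (Rmult_lt_compat_l B) in Hn; [|lra].
    replace (B * (x / (2 * B))) with (x / 2) in Hn by (field; lra). lra.
Qed.

Lemma cis_pow (t : R) (k : nat) : (cis t ^ k)%C = cis (INR k * t).
Proof.
  induction k as [|k IH].
  - simpl; unfold cis; rewrite Rmult_0_l, cos_0, sin_0; reflexivity.
  - simpl Cpow. rewrite IH, S_INR; unfold cis, Cmult; simpl.
    replace ((INR k + 1) * t) with (t + INR k * t) by ring.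
    rewrite cos_plus, sin_plus; f_equal; ring.
Qed.

Lemma cis_neq_0 (t : R) : cis t <> 0%C.
Proof. apply Cmod_gt_0; rewrite Cmod_cis; lra. Qed.

Lemma is_CInt_inv_cis_pow (k : nat) : (0 < k)%nat ->
  is_RInt (V := CV) (fun t => (/ cis t) ^ k)%C 0 (2 * PI) (RtoC 0).
Proof.
  intros Hk.
  assert (Hk' : 0 < INR k) by (apply lt_0_INR, Hk).
  assert (Hinv : forall t, (/ cis t)%C = cis (- t)%R).
  { intros t. assert (H : (cis t * cis (- t)%R)%C = 1%C).
    { unfold cis, Cmult; simpl; rewrite cos_neg, sin_neg.
      apply injective_projections; simpl; [|ring].
      generalize (sin2_cos2 t); unfold Rsqr; lra. }
    replace (cis (- t)) with (/ cis t * (cis t * cis (- t)%R))%C by (field; apply cis_neq_0).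
    rewrite H; ring. }
  apply (is_RInt_ext (V := CV) (fun t => cis (INR k * - t))).
  { intros t _; rewrite Hinv, cis_pow; reflexivity. }
  assert (Hper : sin (INR k * - (2 * PI)) = 0 /\ cos (INR k * - (2 * PI)) = 1).
  { replace (INR k * - (2 * PI)) with (- (0 + 2 * INR k * PI)) by ring.
    rewrite sin_neg, cos_neg, sin_period, cos_period, sin_0, cos_0; lra. }
  replace (RtoC 0) with (sin (INR k * - (2 * PI)) / (- INR k) - sin (INR k * - 0) / (- INR k),
    (- cos (INR k * - (2 * PI))) / (- INR k) - (- cos (INR k * - 0)) / (- INR k)).
  - apply (is_RInt_fct_extend_pair (U := R_NormedModule) (V := R_NormedModule)); simpl.
    + apply (is_RInt_R_of_derive (fun t => sin (INR k * - t) / (- INR k))); intros t.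
      * auto_derive; trivial; field; lra.
      * apply (ex_derive_continuous (K := R_AbsRing) (V := R_NormedModule)); auto_derive; trivial.
    + apply (is_RInt_R_of_derive (fun t => - cos (INR k * - t) / (- INR k))); intros t.
      * auto_derive; trivial; field; lra.
      * apply (ex_derive_continuous (K := R_AbsRing) (V := R_NormedModule)); auto_derive; trivial.
  - destruct Hper as [-> ->]. rewrite Ropp_0, Rmult_0_r, sin_0, cos_0.
    unfold RtoC; f_equal; field; lra.
Qed.

(** The kernel [k th] equals [Ci / (1 - zeta / (rho * cis th))], a geometric series whose ratio has
    modulus [Cmod zeta / rho]. Asking only for continuity of [f] on the circle lets the estimate
    serve twice: for the constant 1, which gives the mass of the kernel, and for [F], which gives
    its Taylor series. *)
Lemma circle_geometric_expansion (f : R -> C) (rho M : R) (zeta : C) (n : nat) :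
  Cmod zeta < rho -> (forall t, ccont f t) -> (forall t, Cmod (f t) <= M) ->
  let k th := (rho * (Ci * cis th) / (rho * cis th - zeta))%C in
  Cmod (CInt (fun th => (f th * k th)%C) 0 (2 * PI)
        - Ci * Csum n (fun j => CInt (fun th => f th * (/ (rho * cis th)) ^ j)%C 0 (2 * PI)
                             * zeta ^ j)%C)
  <= 2 * PI * (M * ((Cmod zeta / rho) ^ n * (rho / (rho - Cmod zeta)))).
Proof.
  intros Hz Hf HM k.
  pose proof (Cmod_ge_0 zeta) as Hz0. pose proof PI_RGT_0 as HPI.
  assert (Hr0 : RtoC rho <> 0%C) by (intros H; apply RtoC_inj in H; lra).
  assert (Hrc : forall th, Cmod (rho * cis th) = rho).
  { intros; rewrite Cmod_mult, Cmod_R, Cmod_cis, Rabs_pos_eq; lra. }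
  assert (Hrn : forall th, (rho * cis th)%C <> 0%C).
  { intros; apply Cmod_gt_0; rewrite Hrc; lra. }
  assert (Hp1 : forall th, rho - Cmod zeta <= Cmod (rho * cis th - zeta)).
  { intros th; rewrite <- (Hrc th) at 1; apply Cmod_minus_ge. }
  assert (Hp0 : forall th, (rho * cis th - zeta)%C <> 0%C).
  { intros th; apply Cmod_gt_0; specialize (Hp1 th); lra. }
  set (v th := (/ (rho * cis th))%C).
  assert (Hcv : forall th, ccont v th).
  { intros th; apply continuous_Cinv; [|apply Hrn].
    apply continuous_Cmult; [apply continuous_const|apply continuous_cis]. }
  assert (Hck : forall th, ccont k th).
  { intros th; apply continuous_Cmult.
    - apply continuous_Cmult; [apply continuous_const|].
      apply continuous_Cmult; [apply continuous_const|apply continuous_cis].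
    - apply (continuous_Cinv (fun th => rho * cis th - zeta)%C); [|apply Hp0].
      apply continuous_Cplus; [|apply continuous_const].
      apply continuous_Cmult; [apply continuous_const|apply continuous_cis]. }
  assert (Hcvj : forall j th, ccont (fun th => v th ^ j)%C th).
  { intros j th; induction j as [|j IH]; simpl; [apply continuous_const|].
    apply continuous_Cmult; [apply Hcv|apply IH]. }
  assert (Hfk : is_RInt (V := CV) (fun th => f th * k th)%C 0 (2 * PI)
     (CInt (fun th => (f th * k th)%C) 0 (2 * PI))).
  { apply (RInt_correct (V := CV)), ex_CInt; [lra|]; intros; apply continuous_Cmult; trivial. }
  assert (Hfv : forall j, is_RInt (V := CV) (fun th => zeta ^ j * (f th * v th ^ j))%C 0 (2 * PI)
     (zeta ^ j * CInt (fun th => f th * v th ^ j)%C 0 (2 * PI))%C).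
  { intros j; apply is_CInt_mult_l, (RInt_correct (V := CV)), ex_CInt; [lra|].
    intros; apply continuous_Cmult; trivial. }
  pose proof (is_CInt_minus _ _ _ _ _ _ Hfk
    (is_CInt_mult_l Ci _ _ _ _ (is_CInt_Csum n _ _ _ _ Hfv))) as HI.
  cbv beta in HI.
  rewrite (Csum_ext n (fun j => CInt _ _ _ * zeta ^ j)%C
    (fun j => zeta ^ j * CInt (fun th => f th * v th ^ j)%C 0 (2 * PI))%C)
    by (intros; apply Cmult_comm).
  rewrite <- (is_RInt_unique (V := CV) _ _ _ _ HI).
  rewrite <- (Rminus_0_r (2 * PI)) at 2.
  apply CInt_bound; [lra|eexists; apply HI|].
  intros th _.
  assert (Hu : Cmod (zeta * v th) = Cmod zeta / rho).
  { unfold v; rewrite Cmod_mult, Cmod_inv, Hrc by apply Hrn; reflexivity. }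
  assert (Hu1 : (zeta * v th)%C <> 1%C).
  { intros H; rewrite H, Cmod_1 in Hu.
    assert (Cmod zeta / rho < 1) by (apply div_lt_1; lra). lra. }
  assert (H1u : (1 - zeta * v th)%C = ((rho * cis th - zeta) * v th)%C).
  { unfold v; field. split; [apply cis_neq_0|exact Hr0]. }
  replace (f th * k th - Ci * Csum n (fun j => zeta ^ j * (f th * v th ^ j)))%C
    with (Ci * f th * ((zeta * v th) ^ n * / (1 - zeta * v th)))%C.
  - rewrite H1u, !Cmod_mult, Cmod_Ci, Rmult_1_l, Cmod_pow.
    apply Rmult_le_compat; try apply Cmod_ge_0; trivial.
    + apply Rmult_le_pos; [apply pow_le, Cmod_ge_0|apply Cmod_ge_0].
    + rewrite Hu. apply Rmult_le_compat_l.
      * apply pow_le, Rle_mult_inv_pos; lra.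
      * rewrite Cmod_inv, Cmod_mult.
        -- unfold v; rewrite Cmod_inv, Hrc by apply Hrn.
           replace (rho / (rho - Cmod zeta)) with (/ ((rho - Cmod zeta) * / rho)) by (field; lra).
           apply Rinv_le_contravar.
           ++ apply Rmult_lt_0_compat; [lra|apply Rinv_0_lt_compat; lra].
           ++ apply Rmult_le_compat_r; [left; apply Rinv_0_lt_compat; lra|apply Hp1].
        -- rewrite <- H1u; intros H; apply Hu1.
           replace (zeta * v th)%C with (1 - (1 - zeta * v th))%C by ring. rewrite H; ring.
  - rewrite <- geometric_remainder by exact Hu1.
    rewrite (Csum_ext n (fun j => zeta ^ j * (f th * v th ^ j))%C
      (fun j => f th * (zeta * v th) ^ j)%C)
      by (intros; rewrite Cpow_mult_l; ring).
    rewrite Csum_mult_l, H1u.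
    change (Csum n (Cpow (zeta * v th))) with (Csum n (fun j => (zeta * v th) ^ j)%C).
    generalize (Csum n (fun j => (zeta * v th) ^ j)%C); intros S; unfold k, v; field.
    split; [apply Hp0|split; [apply cis_neq_0|exact Hr0]].
Qed.

(** For the constant function 1 every coefficient of the geometric expansion except the zeroth
    vanishes, because negative powers of [cis] have mean zero. The error is then the same number for
    all truncation orders and is dominated by a null sequence. *)
Lemma circle_kernel_mass (rho : R) (zeta : C) : Cmod zeta < rho ->
  CInt (fun th => rho * (Ci * cis th) / (rho * cis th - zeta))%C 0 (2 * PI)
  = (Ci * RtoC (2 * PI))%C.
Proof.
  intros Hz. pose proof (Cmod_ge_0 zeta) as Hz0.
  set (k th := (rho * (Ci * cis th) / (rho * cis th - zeta))%C).
  set (I := CInt k 0 (2 * PI)).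
  assert (Haux : (I - Ci * RtoC (2 * PI))%C = 0%C).
  { apply Cmod_eq_0.
    apply (le_geometric_eq_0 _ (2 * PI * (rho / (rho - Cmod zeta)) * (Cmod zeta / rho))
      (Cmod zeta / rho)).
    - split; [apply Rle_mult_inv_pos; lra|apply div_lt_1; lra].
    - apply Cmod_ge_0.
    - intros n.
      pose proof (circle_geometric_expansion (fun _ => 1%C) rho 1 zeta (S n) Hz
        (fun t => continuous_const _ _)) as H.
      specialize (H ltac:(intros; cbv beta; rewrite Cmod_1; lra)). cbv zeta in H.
      rewrite (RInt_ext (V := CV) _ k) in H
        by (intros; apply Cmult_1_l).
      fold I in H.
      rewrite Csum_S_l in H.
      rewrite (Csum_ext n _ (fun _ => 0 * 0)%C) in H.
      + rewrite Csum_mult_l in H.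
        rewrite (RInt_ext (V := CV) _ (fun _ => RtoC 1)) in H by (intros; apply Cmult_1_l).
        rewrite (is_RInt_unique (V := CV) _ _ _ _ (is_CInt_const 1 0 (2 * PI))) in H.
        rewrite Rminus_0_r in H.
        replace (Ci * (2 * PI)%R)%C with (Ci * ((2 * PI)%R * 1 * zeta ^ 0 + 0 * Csum n (fun _ => 0)))%C
          by (simpl; ring).
        eapply Rle_trans; [exact H|]. simpl; right; ring.
      + intros j _.
        assert (H0 : is_RInt (V := CV) (fun th => 1 * (/ (rho * cis th)) ^ S j)%C 0 (2 * PI)
          ((/ rho) ^ S j * 0)%C).
        { apply (is_RInt_ext (V := CV) (fun th => (/ rho) ^ S j * (/ cis th) ^ S j)%C).
          - intros t _. rewrite Cmult_1_l, <- Cpow_mult_l. f_equal.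
            field. split; [apply cis_neq_0|intros H0; apply RtoC_inj in H0; lra].
          - apply is_CInt_mult_l, is_CInt_inv_cis_pow; lia. }
        rewrite (is_RInt_unique (V := CV) _ _ _ _ H0). ring. }
  assert (Haux2 : forall A B : C, (A - B)%C = 0%C -> A = B).
  { intros A B H; replace A with ((A - B) + B)%C by ring; rewrite H; ring. }
  exact (Haux2 _ _ Haux).
Qed.

Lemma Cmod_circle (c : C) (rho t : R) : 0 <= rho -> Cmod (c + RtoC rho * cis t - c) = rho.
Proof.
  intros H; replace (c + RtoC rho * cis t - c)%C with (RtoC rho * cis t)%C by ring.
  rewrite Cmod_mult, Cmod_R, Cmod_cis, Rabs_pos_eq; lra.
Qed.

(** [M] bounds [F] only on the circle of radius [rho]. This matters later, when [rho] is [/ om] and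
    the smallness of the function is known on that circle. *)
Lemma taylor_at_0 (F : C -> C) (r rho M : R) :
  0 < rho < r -> (forall z, Cmod z < r -> cdiff F z) ->
  (forall t, Cmod (F (RtoC rho * cis t)%C) <= M) ->
  exists a : nat -> C, (forall k, Cmod (a k) <= M / rho ^ k) /\
    forall z n, Cmod z < rho ->
      Cmod (F z - Csum n (fun k => a k * z ^ k)%C)
      <= M * ((Cmod z / rho) ^ n * (rho / (rho - Cmod z))).
Proof.
  intros Hr HF HM'. pose proof PI_RGT_0 as HPI.
  assert (Hr0 : RtoC rho <> 0%C) by (intros H; apply RtoC_inj in H; lra).
  assert (Hrc : forall th, Cmod (rho * cis th) = rho).
  { intros; rewrite Cmod_mult, Cmod_R, Cmod_cis, Rabs_pos_eq; lra. }
  assert (Hrn : forall th, (rho * cis th)%C <> 0%C).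
  { intros; apply Cmod_gt_0; rewrite Hrc; lra. }
  assert (Hcrc : forall th, ccont (fun th => rho * cis th)%C th).
  { intros th; apply continuous_Cmult; [apply continuous_const|apply continuous_cis]. }
  assert (HcF : forall th, ccont (fun th => F (rho * cis th)%C) th).
  { intros th; apply (continuous_comp (fun th => rho * cis th)%C F); [apply Hcrc|].
    apply cdiff_continuous, HF; rewrite Hrc; lra. }
  assert (Hcv : forall j th, ccont (fun th => F (rho * cis th)%C * (/ (rho * cis th)) ^ j)%C th).
  { intros j th; apply continuous_Cmult; [apply HcF|].
    induction j as [|j IH]; simpl; [apply continuous_const|].
    apply continuous_Cmult; [apply continuous_Cinv; [apply Hcrc|apply Hrn]|apply IH]. }
  set (A j := CInt (fun th => F (rho * cis th)%C * (/ (rho * cis th)) ^ j)%C 0 (2 * PI)).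
  assert (H2pi : Cmod (/ RtoC (2 * PI)) = / (2 * PI)).
  { rewrite Cmod_inv by (intros H; apply RtoC_inj in H; lra).
    rewrite Cmod_R, Rabs_pos_eq by lra; reflexivity. }
  exists (fun j => / RtoC (2 * PI) * A j)%C; split.
  - intros k. rewrite Cmod_mult, H2pi.
    assert (HA : Cmod (A k) <= (2 * PI - 0) * (M / rho ^ k)).
    { apply CInt_bound; [lra|apply ex_CInt; [lra|intros; apply Hcv]|].
      intros th _; rewrite Cmod_mult, Cmod_pow, Cmod_inv, Hrc by apply Hrn.
      unfold Rdiv; rewrite pow_inv. apply Rmult_le_compat_r; trivial.
      left; apply Rinv_0_lt_compat, pow_lt; lra. }
    apply (Rmult_le_compat_l (/ (2 * PI))) in HA; [|left; apply Rinv_0_lt_compat; lra].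
    replace (/ (2 * PI) * ((2 * PI - 0) * (M / rho ^ k))) with (M / rho ^ k) in HA; trivial.
    field. split; [apply pow_nonzero|]; lra.
  - intros z n Hz.
    pose proof (circle_geometric_expansion _ rho M z n Hz HcF HM') as H; cbv beta zeta in H.
    rewrite (circle_kernel_integral F r rho z) in H by (trivial; lra).
    rewrite circle_kernel_mass in H by exact Hz.
    replace (F z - Csum n (fun k => / RtoC (2 * PI) * A k * z ^ k))%C with
      (/ RtoC (2 * PI) * / Ci * (F z * (Ci * RtoC (2 * PI)) - Ci * Csum n (fun j => A j * z ^ j)))%C.
    + rewrite !Cmod_mult, H2pi, Cmod_inv, Cmod_Ci by (intros HC; injection HC; lra).
      eapply Rle_trans; [apply Rmult_le_compat_l; [|exact H]|].
      * rewrite Rinv_1, Rmult_1_r; left; apply Rinv_0_lt_compat; lra.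
      * right. pose proof (Cmod_ge_0 z). field. lra.
    + rewrite (Csum_ext n (fun k => / RtoC (2 * PI) * A k * z ^ k)%C
        (fun k => / RtoC (2 * PI) * (A k * z ^ k))%C) by (intros; ring).
      rewrite Csum_mult_l. field.
      split; [intros HC; apply RtoC_inj in HC; lra|intros HC; injection HC; lra].
Qed.

Lemma cdiff_translate (F : C -> C) (c z : C) : cdiff F (c + z) -> cdiff (fun w => F (c + w)%C) z.
Proof.
  intros [l Hl]; exists l; intros eps Heps; destruct (Hl eps Heps) as [d [Hd Hw]].
  exists d; split; trivial; intros w Hwz.
  replace (w - z)%C with (c + w - (c + z))%C by ring.
  apply Hw. replace (c + w - (c + z))%C with (w - z)%C by ring; exact Hwz.
Qed.

Lemma taylor (F : C -> C) (c : C) (r rho M : R) :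
  0 < rho < r -> (forall z, Cmod (z - c) < r -> cdiff F z) ->
  (forall t, Cmod (F (c + RtoC rho * cis t)%C) <= M) ->
  exists a : nat -> C, (forall k, Cmod (a k) <= M / rho ^ k) /\
    forall z n, Cmod (z - c) < rho ->
      Cmod (F z - Csum n (fun k => a k * (z - c) ^ k)%C)
      <= M * ((Cmod (z - c) / rho) ^ n * (rho / (rho - Cmod (z - c)))).
Proof.
  intros Hr HF HM.
  assert (Hcw : forall w, (c + w - c = w)%C) by (intros; ring).
  destruct (taylor_at_0 (fun w => F (c + w)%C) r rho M Hr) as [a [Ha Hser]].
  - intros z Hz; apply cdiff_translate, HF; rewrite Hcw; exact Hz.
  - exact HM.
  - exists a; split; trivial; intros z n Hz.
    specialize (Hser (z - c)%C n Hz).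
    replace (c + (z - c))%C with z in Hser by ring; exact Hser.
Qed.

(** * Restriction to the real line and the mean of [g o phi] *)

(** What [taylor] leaves for the real or imaginary part on the real line: Cauchy's bounds on the
    coefficients and a geometric remainder. [sum_f_R0 _ n] has n+1 terms, hence the exponent
    [S n]. *)
Definition expansion (u : R -> R) (c rho M : R) (b : nat -> R) : Prop :=
  (forall k, Rabs (b k) <= M / rho ^ k) /\
  forall x n, Rabs (x - c) < rho ->
    Rabs (u x - sum_f_R0 (fun k => b k * (x - c) ^ k) n)
    <= M * ((Rabs (x - c) / rho) ^ S n * (rho / (rho - Rabs (x - c)))).

Lemma snd_le_Cmod (z : C) : Rabs (snd z) <= Cmod z.
Proof. eapply Rle_trans; [apply Rmax_r|apply Rmax_Cmod]. Qed.

Lemma taylor_real (F : C -> C) (c r rho M : R) :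
  0 < rho < r -> (forall z, Cmod (z - RtoC c) < r -> cdiff F z) ->
  (forall t, Cmod (F (RtoC c + RtoC rho * cis t)%C) <= M) ->
  (exists b, expansion (fun t => fst (F (RtoC t))) c rho M b) /\
  (exists b, expansion (fun t => snd (F (RtoC t))) c rho M b).
Proof.
  intros Hr HF HM.
  destruct (taylor F c r rho M Hr HF HM) as [a [Ha Hser]].
  assert (Hsum : forall x n,
    Csum (S n) (fun k => a k * (RtoC x - RtoC c) ^ k)%C
    = (sum_f_R0 (fun k => fst (a k) * (x - c) ^ k) n, sum_f_R0 (fun k => snd (a k) * (x - c) ^ k) n)).
  { intros x n.
    assert (Hk : forall k, (a k * (RtoC x - RtoC c) ^ k)%C
       = (fst (a k) * (x - c) ^ k, snd (a k) * (x - c) ^ k)).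
    { intros k; rewrite <- RtoC_minus, <- RtoC_pow; unfold Cmult; simpl; f_equal; ring. }
    induction n as [|n IH].
    - rewrite Csum_S, Hk; unfold Csum, Cplus; simpl; f_equal; ring.
    - rewrite Csum_S, IH, Hk; reflexivity. }
  split; [exists (fun k => fst (a k))|exists (fun k => snd (a k))]; split.
  - intros k; eapply Rle_trans; [apply re_le_Cmod|apply Ha].
  - intros x n Hx.
    specialize (Hser x (S n)). rewrite Hsum, <- RtoC_minus, Cmod_R in Hser.
    eapply Rle_trans; [|apply Hser, Hx].
    eapply Rle_trans; [|apply re_le_Cmod]; simpl; right; reflexivity.
  - intros k; eapply Rle_trans; [apply snd_le_Cmod|apply Ha].
  - intros x n Hx.
    specialize (Hser x (S n)). rewrite Hsum, <- RtoC_minus, Cmod_R in Hser.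
    eapply Rle_trans; [|apply Hser, Hx].
    eapply Rle_trans; [|apply snd_le_Cmod]; simpl; right; reflexivity.
Qed.

Lemma is_lim_seq_of_geometric (u : nat -> R) (l B q : R) : 0 <= q < 1 ->
  (forall n, Rabs (u n - l) <= B * q ^ n) -> is_lim_seq u l.
Proof.
  intros Hq H.
  assert (Hg : is_lim_seq (fun n => B * q ^ n) 0).
  { replace (Finite 0) with (Rbar_mult B 0) by (simpl; f_equal; ring).
    apply is_lim_seq_scal_l, is_lim_seq_geom; rewrite Rabs_pos_eq; lra. }
  apply (is_lim_seq_le_le (fun n => l - B * q ^ n) _ (fun n => l + B * q ^ n)).
  - intros n; specialize (H n); apply Rabs_le_between in H; lra.
  - replace (Finite l) with (Finite (l - 0)) by (f_equal; ring).
    apply (is_lim_seq_minus' _ _ l 0); [apply is_lim_seq_const|exact Hg].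
  - replace (Finite l) with (Finite (l + 0)) by (f_equal; ring).
    apply (is_lim_seq_plus' _ _ l 0); [apply is_lim_seq_const|exact Hg].
Qed.

Lemma expansion_PSeries (u : R -> R) (c rho M : R) (b : nat -> R) (x : R) :
  expansion u c rho M b -> Rabs (x - c) < rho -> PSeries b (x - c) = u x.
Proof.
  intros [_ H] Hx; pose proof (Rabs_pos (x - c)) as H0.
  apply is_pseries_unique.
  change (is_lim_seq (sum_n (fun k => scal (pow_n (x - c) k) (b k))) (u x)).
  apply (is_lim_seq_ext (sum_f_R0 (fun k => b k * (x - c) ^ k))).
  - intros n; rewrite <- sum_n_Reals; apply sum_n_ext; intros k.
    change (b k * (x - c) ^ k = pow_n (K := R_Ring) (x - c) k * b k).
    rewrite (Rmult_comm (b k)); exact (f_equal (fun y => y * b k) (eq_sym (pow_n_pow (x - c) k))).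
  - apply (is_lim_seq_of_geometric _ _
      (M * (Rabs (x - c) / rho * (rho / (rho - Rabs (x - c))))) (Rabs (x - c) / rho)).
    + split; [apply Rle_mult_inv_pos; lra|apply div_lt_1; lra].
    + intros n; rewrite Rabs_minus_sym; eapply Rle_trans; [apply H, Hx|simpl; right; ring].
Qed.

(** The coefficient bounds make the radius of convergence at least [rho], so the series may be
    differentiated termwise near its centre. *)
Lemma expansion_derivatives (u : R -> R) (c rho M : R) (b : nat -> R) (j : nat) : 0 < rho ->
  expansion u c rho M b ->
  ex_derive_n u j c /\ Derive_n u j c = INR (fact j) * b j.
Proof.
  intros Hrho Hu.
  assert (Hloc : locally (T := R_UniformSpace) c (fun t => PSeries b (t + - c) = u t)).
  { exists (mkposreal rho Hrho); intros t Ht.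
    apply (expansion_PSeries u c rho M b); trivial. }
  assert (HR : Rbar_lt (Rabs (c + - c)) (CV_radius b)).
  { apply Rbar_lt_le_trans with rho; [simpl; rewrite Rplus_opp_r, Rabs_R0; lra|].
    apply (proj1 (CV_radius_bounded b)). exists M; intros n.
    destruct Hu as [Hb _]; specialize (Hb n).
    rewrite Rabs_mult, (Rabs_pos_eq (rho ^ n)) by (apply pow_le; lra).
    apply (Rmult_le_compat_r (rho ^ n)) in Hb; [|apply pow_le; lra].
    replace (M / rho ^ n * rho ^ n) with M in Hb by (field; apply pow_nonzero; lra).
    exact Hb. }
  split.
  - apply (ex_derive_n_ext_loc _ _ _ _ Hloc), ex_derive_n_comp_trans.
    destruct j as [|j]; [exact I|].
    eexists; apply (is_derive_n_PSeries (S j) b _ HR).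
  - rewrite <- (Derive_n_ext_loc _ _ _ _ Hloc), Derive_n_comp_trans.
    rewrite Derive_n_PSeries by exact HR.
    rewrite Rplus_opp_r, PSeries_0; unfold PS_derive_n; simpl.
    field.
Qed.

(** Cauchy's estimate, together with the link that makes [Derive_n u] a chain of successive
    derivatives as required for repeated integration by parts. *)
Lemma expansion_derive_bound (u : R -> R) (c rho M : R) (b : nat -> R) (j : nat) : 0 < rho ->
  expansion u c rho M b ->
  is_derive (Derive_n u j) c (Derive_n u (S j) c) /\
  Rabs (Derive_n u j c) <= INR (fact j) * (M / rho ^ j).
Proof.
  intros Hrho Hu; split.
  - apply Derive_correct, (expansion_derivatives u c rho M b (S j) Hrho Hu).
  - rewrite (proj2 (expansion_derivatives u c rho M b j Hrho Hu)), Rabs_mult.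
    rewrite Rabs_pos_eq by apply pos_INR.
    apply Rmult_le_compat_l; [apply pos_INR|apply Hu].
Qed.

(** * Moments of sine and cosine over a period *)

(** Writing the derivative as a shift by a quarter period treats sine and cosine at once. *)
Lemma is_derive_phi (s : bool) (t : R) : is_derive (phi s 1) t (phi s 1 (t + PI / 2)).
Proof.
  unfold phi; destruct s; auto_derive; trivial; rewrite !Rmult_1_l.
  - rewrite sin_plus, cos_PI2, sin_PI2; ring.
  - rewrite cos_plus, cos_PI2, sin_PI2; ring.
Qed.

Lemma phi_quarter_sq (s : bool) (t : R) : phi s 1 (t + PI / 2) ^ 2 = 1 - phi s 1 t ^ 2.
Proof.
  pose proof (sin2_cos2 t) as H; unfold Rsqr in H.
  unfold phi; destruct s; rewrite !Rmult_1_l.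
  - rewrite sin_plus, cos_PI2, sin_PI2; nra.
  - rewrite cos_plus, cos_PI2, sin_PI2; nra.
Qed.

Lemma phi_half (s : bool) (t : R) : phi s 1 (t + PI / 2 + PI / 2) = - phi s 1 t.
Proof.
  unfold phi; replace (t + PI / 2 + PI / 2) with (t + PI) by field.
  destruct s; rewrite !Rmult_1_l; [apply neg_sin|apply neg_cos].
Qed.

Lemma phi_period (s : bool) (t : R) : phi s 1 (t + 2 * PI) = phi s 1 t.
Proof.
  unfold phi; rewrite !Rmult_1_l.
  destruct s; [rewrite <- (sin_period t 1)|rewrite <- (cos_period t 1)]; f_equal; simpl; ring.
Qed.

Lemma phi_bound (s : bool) (t : R) : -1 <= phi s 1 t <= 1.
Proof. unfold phi; destruct s; [apply SIN_bound|apply COS_bound]. Qed.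

Lemma continuous_phi (s : bool) (t : R) : continuous (phi s 1) t.
Proof.
  apply (ex_derive_continuous (K := R_AbsRing) (V := R_NormedModule)).
  eexists; apply is_derive_phi.
Qed.

Lemma continuous_phi_pow (s : bool) (k : nat) (t : R) : continuous (fun t => phi s 1 t ^ k) t.
Proof.
  induction k as [|k IH]; simpl; [apply continuous_const|].
  apply (continuous_mult (K := R_AbsRing)); [apply continuous_phi|apply IH].
Qed.

(** Wallis' recursion. With p = [phi s 1], the derivative of p' p^(k+1) is (k+1) p'^2 p^k - p^(k+2),
    and p'^2 = 1 - p^2 makes it (k+1) p^k - (k+2) p^(k+2); its integral over a period is zero. *)
Lemma is_RInt_phi_pow_SS (s : bool) (k : nat) (W : R) :
  is_RInt (fun t => phi s 1 t ^ k) 0 (2 * PI) W ->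
  is_RInt (fun t => phi s 1 t ^ (S (S k))) 0 (2 * PI) (INR (S k) / INR (S (S k)) * W).
Proof.
  intros HW.
  assert (Hk : INR (S (S k)) <> 0) by (apply not_0_INR; lia).
  pose proof (is_RInt_R_of_derive
    (fun t => phi s 1 (t + PI / 2) * phi s 1 t ^ S k)
    (fun t => INR (S k) * phi s 1 t ^ k - INR (S (S k)) * phi s 1 t ^ (S (S k))) 0 (2 * PI)) as H.
  assert (HD : is_RInt (fun t => INR (S k) * phi s 1 t ^ k - INR (S (S k)) * phi s 1 t ^ (S (S k)))
     0 (2 * PI) 0).
  { replace 0 with (phi s 1 (2 * PI + PI / 2) * phi s 1 (2 * PI) ^ S k
       - phi s 1 (0 + PI / 2) * phi s 1 0 ^ S k) at 2.
    - apply H; intros t.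
      + assert (Hq : is_derive (fun t => phi s 1 (t + PI / 2)) t (- phi s 1 t)).
        { rewrite <- phi_half.
          replace (phi s 1 (t + PI / 2 + PI / 2)) with (1 * phi s 1 (t + PI / 2 + PI / 2)) by ring.
          apply (is_derive_comp (phi s 1) (fun t => t + PI / 2)); [apply is_derive_phi|].
          auto_derive; trivial; ring. }
        pose proof (is_derive_pow (phi s 1) (S k) t _ (is_derive_phi s t)) as Hp.
        pose proof (is_derive_mult _ _ t _ _ Hq Hp Rmult_comm) as HH.
        unfold plus, mult in HH; simpl in HH.
        match type of HH with is_derive _ _ ?l => match goal with |- is_derive _ _ ?r =>
          replace r with l; [exact HH|] end end.
        pose proof (phi_quarter_sq s t) as Hs.
        rewrite !S_INR. simpl pow in *.
        change (match k with 0%nat => 1 | S _ => INR k + 1 end) with (INR (S k)).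
        rewrite !S_INR.
        replace (phi s 1 (t + PI / 2) * ((INR k + 1) * phi s 1 (t + PI / 2) * phi s 1 t ^ k))
          with ((INR k + 1) * (phi s 1 (t + PI / 2) * (phi s 1 (t + PI / 2) * 1)) * phi s 1 t ^ k) by ring.
        rewrite Hs. ring.
      + apply (continuous_minus (V := R_NormedModule));
        apply (continuous_mult (K := R_AbsRing)); try apply continuous_const;
        apply continuous_phi_pow.
    - replace (2 * PI + PI / 2) with (0 + PI / 2 + 2 * PI) by ring.
      rewrite phi_period. replace (2 * PI) with (0 + 2 * PI) by ring.
      rewrite phi_period; ring. }
  pose proof (is_RInt_minus (V := R_NormedModule) _ _ _ _ _ _
    (is_RInt_scal (V := R_NormedModule) _ _ _ (INR (S k)) _ HW) HD) as HM.
  pose proof (is_RInt_scal (V := R_NormedModule) _ _ _ (/ INR (S (S k))) _ HM) as HF.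
  replace (INR (S k) / INR (S (S k)) * W) with (/ INR (S (S k)) * (INR (S k) * W - 0)) by (field; exact Hk).
  eapply (is_RInt_ext (V := R_NormedModule)); [|exact HF].
  intros t _; unfold scal, minus, plus, opp; simpl; unfold mult; simpl.
  change (match k with 0%nat => 1 | S _ => INR k + 1 end) with (INR (S k)).
  match goal with |- ?l = ?r => change (@eq R l r) end.
  rewrite !S_INR in *; field; exact Hk.
Qed.

(** The factor (2j)! in the even moments cancels the one in the Taylor coefficient of [g], which
    leaves the denominators (j!)^2 4^j of [rho0]. *)
Lemma is_RInt_phi_pow (s : bool) (j : nat) :
  is_RInt (fun t => phi s 1 t ^ (2 * j)) 0 (2 * PI)
    (2 * PI * (INR (fact (2 * j)) / (INR (fact j) ^ 2 * 4 ^ j))) /\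
  is_RInt (fun t => phi s 1 t ^ (S (2 * j))) 0 (2 * PI) 0.
Proof.
  induction j as [|j [IH1 IH2]].
  - split.
    + replace (2 * PI * (INR (fact (2 * 0)) / (INR (fact 0) ^ 2 * 4 ^ 0)))
        with (scal (V := R_NormedModule) (2 * PI - 0) 1).
      * apply (is_RInt_const (V := R_NormedModule) 0 (2 * PI) 1).
      * unfold scal; simpl; unfold mult; simpl; field.
    + pose proof (is_RInt_R_of_derive (fun t => - phi s 1 (t + PI / 2)) (phi s 1) 0 (2 * PI)) as H.
      replace 0 with (- phi s 1 (2 * PI + PI / 2) - - phi s 1 (0 + PI / 2)) at 2.
      * eapply (is_RInt_ext (V := R_NormedModule)); [|apply H].
        -- intros t _; simpl; match goal with |- ?l = ?r => change (@eq R l r) end; ring.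
        -- intros t. replace (phi s 1 t) with (opp (1 * phi s 1 (t + PI / 2 + PI / 2))).
           ++ apply (is_derive_opp (V := R_NormedModule)).
              apply (is_derive_comp (phi s 1) (fun t => t + PI / 2)); [apply is_derive_phi|].
              auto_derive; trivial; ring.
           ++ rewrite phi_half; unfold opp; simpl; ring.
        -- apply continuous_phi.
      * replace (2 * PI + PI / 2) with (0 + PI / 2 + 2 * PI) by ring.
        rewrite phi_period; ring.
  - replace (2 * S j)%nat with (S (S (2 * j))) by lia. split.
    + pose proof (is_RInt_phi_pow_SS s _ _ IH1) as H.
      match type of H with is_RInt _ _ _ ?l => match goal with |- is_RInt _ _ _ ?r =>
        replace r with l; [exact H|] end end.
      rewrite (fact_simpl (S (2 * j))), (fact_simpl (2 * j)), (fact_simpl j), !mult_INR, !S_INR, mult_INR.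
      simpl pow; simpl (INR 2). pose proof (pos_INR j).
      field. split; [apply pow_nonzero; lra|]. split; [apply INR_fact_neq_0|lra].
    + pose proof (is_RInt_phi_pow_SS s _ _ IH2) as H. rewrite Rmult_0_r in H. exact H.
Qed.

Lemma is_RInt_sum_f_R0 (f : nat -> R -> R) (W : nat -> R) (a b : R) (n : nat) :
  (forall k, is_RInt (f k) a b (W k)) ->
  is_RInt (fun t => sum_f_R0 (fun k => f k t) n) a b (sum_f_R0 W n).
Proof.
  intros H; induction n as [|n IH]; simpl; [apply H|].
  apply (is_RInt_plus (V := R_NormedModule)); trivial.
Qed.

(** Termwise integration of the Taylor series of [g] at 0 composed with [phi]. The assumption
    [1 < rho] makes the convergence uniform on [-1,1], the range of [phi]. *)
Lemma mean_value (g : R -> R) (s : bool) (rho M : R) (b : nat -> R) :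
  1 < rho -> 0 <= M -> expansion g 0 rho M b ->
  (forall t, continuous (fun t => g (phi s 1 t)) t) ->
  is_RInt (fun t => g (phi s 1 t)) 0 (2 * PI) (2 * PI * (rho0 g / 2)).
Proof.
  intros Hrho HM Hg Hc. pose proof PI_RGT_0 as HPI.
  set (w j := INR (fact (2 * j)) / (INR (fact j) ^ 2 * 4 ^ j)).
  set (W k := RInt (fun t => phi s 1 t ^ k) 0 (2 * PI)).
  assert (HW : forall k, is_RInt (fun t => phi s 1 t ^ k) 0 (2 * PI) (W k)).
  { intros k; apply (RInt_correct (V := R_CompleteNormedModule)).
    apply (ex_RInt_continuous (V := R_CompleteNormedModule)); intros; apply continuous_phi_pow. }
  assert (HWe : forall j, W (2 * j)%nat = 2 * PI * w j).
  { intros j; apply is_RInt_unique; exact (proj1 (is_RInt_phi_pow s j)). }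
  assert (HWo : forall j, W (S (2 * j)) = 0).
  { intros j; apply is_RInt_unique; exact (proj2 (is_RInt_phi_pow s j)). }
  assert (Hex : ex_RInt (fun t => g (phi s 1 t)) 0 (2 * PI)).
  { apply (ex_RInt_continuous (V := R_CompleteNormedModule)); intros; apply Hc. }
  set (I := RInt (fun t => g (phi s 1 t)) 0 (2 * PI) : R).
  assert (HI : is_RInt (fun t => g (phi s 1 t)) 0 (2 * PI) I)
    by exact (RInt_correct (V := R_CompleteNormedModule) _ _ _ Hex).
  assert (Hq : 0 <= / rho < 1).
  { split; [left; apply Rinv_0_lt_compat; lra|]. rewrite <- Rinv_1. apply Rinv_lt_contravar; lra. }
  assert (Hrem : forall n, Rabs (I - sum_f_R0 (fun k => b k * W k) n)
     <= 2 * PI * (M * (/ rho ^ S n * (rho / (rho - 1))))).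
  { intros n.
    assert (Hs : is_RInt (fun t => sum_f_R0 (fun k => b k * phi s 1 t ^ k) n) 0 (2 * PI)
       (sum_f_R0 (fun k => b k * W k) n)).
    { apply (is_RInt_sum_f_R0 (fun k t => b k * phi s 1 t ^ k)).
      intros k; apply (is_RInt_scal (V := R_NormedModule)), HW. }
    pose proof (is_RInt_minus (V := R_NormedModule) _ _ _ _ _ _ HI Hs) as HD.
    rewrite <- (Rminus_0_r (2 * PI)) at 1.
    apply (norm_RInt_le_const (V := R_NormedModule) _ 0 (2 * PI) _ _ ltac:(lra)) with (2 := HD).
    intros t _. change (Rabs (g (phi s 1 t) - sum_f_R0 (fun k => b k * phi s 1 t ^ k) n)
      <= M * (/ rho ^ S n * (rho / (rho - 1)))).
    pose proof (phi_bound s t) as Hp. set (y := phi s 1 t) in *.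
    assert (Hy : Rabs (y - 0) <= 1) by (apply Rabs_le; lra).
    pose proof (Rabs_pos (y - 0)) as Hy0.
    replace (sum_f_R0 (fun k => b k * y ^ k) n) with (sum_f_R0 (fun k => b k * (y - 0) ^ k) n)
      by (rewrite Rminus_0_r; reflexivity).
    eapply Rle_trans; [apply (proj2 Hg); lra|].
    apply Rmult_le_compat_l; trivial.
    rewrite <- pow_inv.
    apply Rmult_le_compat.
    - apply pow_le, Rle_mult_inv_pos; lra.
    - apply Rle_mult_inv_pos; lra.
    - apply pow_incr; split; [apply Rle_mult_inv_pos; lra|].
      unfold Rdiv; rewrite <- (Rmult_1_l (/ rho)) at 2. apply Rmult_le_compat_r; lra.
    - apply Rmult_le_compat_l; [lra|]. apply Rinv_le_contravar; lra. }
  (* Odd moments vanish, so stopping at the odd index [S (2 * n)] gives exactly the first n+1 even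
     terms. *)
  assert (Hsplit : forall n, sum_f_R0 (fun k => b k * W k) (S (2 * n))
     = sum_f_R0 (fun j => b (2 * j)%nat * (2 * PI * w j)) n).
  { induction n as [|n IH].
    - simpl sum_f_R0. pose proof (HWo 0%nat) as Ho. pose proof (HWe 0%nat) as He.
      simpl (2 * 0)%nat in *. rewrite Ho, He; ring.
    - replace (S (2 * S n)) with (S (S (S (2 * n)))) by lia.
      rewrite (tech5 _ (S (S (2 * n)))), (tech5 _ (S (2 * n))), IH.
      replace (S (S (2 * n))) with (2 * S n)%nat by lia.
      rewrite HWo, HWe, (tech5 _ n); ring. }
  assert (Hder : forall j, Derive_n g (2 * j) 0 / (INR (fact j) ^ 2 * 4 ^ j) = b (2 * j)%nat * w j).
  { intros j; rewrite (proj2 (expansion_derivatives g 0 rho M b (2 * j) ltac:(lra) Hg)).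
    unfold w; field. split; [apply pow_nonzero; lra|apply INR_fact_neq_0]. }
  assert (HS : Series (fun k => Derive_n g (2 * k) 0 / (INR (fact k) ^ 2 * 4 ^ k)) = I / (2 * PI)).
  { apply is_series_unique.
    change (is_lim_seq (sum_n (fun k => Derive_n g (2 * k) 0 / (INR (fact k) ^ 2 * 4 ^ k))) (I / (2 * PI))).
    apply (is_lim_seq_ext (fun n => sum_f_R0 (fun k => b k * W k) (S (2 * n)) / (2 * PI))).
    - intros n; rewrite sum_n_Reals, Hsplit.
      unfold Rdiv at 1; rewrite (Rmult_comm _ (/ (2 * PI))), scal_sum.
      apply sum_eq; intros i _; rewrite Hder; field; lra.
    - replace (Finite (I / (2 * PI))) with (Rbar_mult I (/ (2 * PI))) by reflexivity.
      apply is_lim_seq_scal_r.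
      apply (is_lim_seq_of_geometric _ _ (2 * PI * (M * (rho / (rho - 1)))) (/ rho)); trivial.
      intros n; rewrite Rabs_minus_sym; eapply Rle_trans; [apply Hrem|].
      rewrite !Rmult_assoc; apply Rmult_le_compat_l; [lra|]; apply Rmult_le_compat_l; [lra|].
      apply Rmult_le_compat_l; trivial.
      rewrite Rmult_comm; apply Rmult_le_compat_l; [apply Rle_mult_inv_pos; lra|].
      rewrite pow_inv. apply Rinv_le_contravar; [apply pow_lt; lra|].
      apply Rle_pow; [lra|lia]. }
  replace (2 * PI * (rho0 g / 2)) with I; trivial.
  unfold rho0; rewrite HS; match goal with |- ?l = ?r => change (@eq R l r) end; field; lra.
Qed.

(** * Oscillatory integrals *)

Lemma periodic_bounded (psi : R -> R) :
  (forall t, continuous psi t) -> (forall t, psi (t + 2 * PI) = psi t) ->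
  exists B, 0 <= B /\ forall t, Rabs (psi t) <= B.
Proof.
  intros Hc Hp. pose proof PI_RGT_0 as HPI.
  destruct (continuity_ab_maj (fun t => Rabs (psi t)) 0 (2 * PI)) as [tm [Hm _]]; [lra| |].
  { intros t _; apply continuity_pt_filterlim.
    apply (continuous_comp psi Rabs); [apply Hc|].
    apply continuity_pt_filterlim, Rcontinuity_abs. }
  exists (Rabs (psi tm)); split; [apply Rabs_pos|].
  assert (Hn : forall n t, psi (t + INR n * (2 * PI)) = psi t).
  { induction n as [|n IH]; intros t.
    - simpl; f_equal; ring.
    - rewrite S_INR. replace (t + (INR n + 1) * (2 * PI)) with (t + INR n * (2 * PI) + 2 * PI) by ring.
      rewrite Hp; apply IH. }
  assert (Hpos : forall t, 0 <= t -> Rabs (psi t) <= Rabs (psi tm)).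
  { intros t Ht. destruct (nfloor_ex (t / (2 * PI))) as [n Hnt].
    { apply Rle_mult_inv_pos; lra. }
    assert (He : t = t / (2 * PI) * (2 * PI)) by (field; lra).
    replace t with (t - INR n * (2 * PI) + INR n * (2 * PI)) by ring.
    rewrite Hn; apply Hm.
    split; rewrite He; nra. }
  (* A shift by n+1 periods exceeds |t|, which reduces a negative argument to a nonnegative one. *)
  intros t. destruct (nfloor_ex (Rabs t / (2 * PI))) as [n Hnt].
  { apply Rle_mult_inv_pos; [apply Rabs_pos|lra]. }
  rewrite <- (Hn (S n)); apply Hpos.
  assert (He : Rabs t = Rabs t / (2 * PI) * (2 * PI)) by (field; lra).
  rewrite S_INR. assert (- Rabs t <= t) by (pose proof (Rle_abs (- t)); rewrite Rabs_Ropp in *; lra).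
  nra.
Qed.

Definition zero_mean_periodic (psi : R -> R) : Prop :=
  (forall t, continuous psi t) /\ (forall t, psi (t + 2 * PI) = psi t) /\
  is_RInt psi 0 (2 * PI) 0.

(** Zero mean of [psi] is what makes its primitive periodic; subtracting the mean [mu] of the
    primitive restores zero mean, so the construction can be iterated. *)
Lemma zero_mean_antiderivative (psi : R -> R) : zero_mean_periodic psi ->
  exists Psi, zero_mean_periodic Psi /\ forall t, is_derive Psi t (psi t).
Proof.
  intros (Hc & Hp & Hm). pose proof PI_RGT_0 as HPI.
  assert (Hi : forall u v, ex_RInt psi u v).
  { intros; apply (ex_RInt_continuous (V := R_CompleteNormedModule)); intros; apply Hc. }
  set (P t := RInt psi 0 t).
  assert (HP : forall t, is_derive P t (psi t)).
  { intros t; apply (is_derive_RInt psi P 0 t); [|apply Hc].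
    apply filter_forall; intros u; apply (RInt_correct (V := R_CompleteNormedModule)), Hi. }
  assert (HPc : forall t, continuous P t).
  { intros t; apply (ex_derive_continuous (K := R_AbsRing) (V := R_NormedModule)).
    eexists; apply HP. }
  set (mu := (RInt P 0 (2 * PI) : R) / (2 * PI)).
  exists (fun t => P t - mu); split; [split; [|split]|].
  - intros t; apply (continuous_minus (V := R_NormedModule)); [apply HPc|apply continuous_const].
  - intros t; f_equal; unfold P.
    rewrite <- (RInt_Chasles (V := R_CompleteNormedModule) psi 0 (2 * PI)) by apply Hi.
    rewrite (is_RInt_unique (V := R_CompleteNormedModule) _ _ _ _ Hm).
    pose proof (RInt_comp_lin (V := R_CompleteNormedModule) psi 1 (2 * PI) 0 t (Hi _ _)) as H.
    replace (1 * 0 + 2 * PI) with (2 * PI) in H by ring.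
    replace (1 * t + 2 * PI) with (t + 2 * PI) in H by ring.
    rewrite <- H. unfold plus; simpl; rewrite Rplus_0_l.
    apply (RInt_ext (V := R_CompleteNormedModule)); intros x _.
    unfold scal; simpl; unfold mult; simpl. rewrite !Rmult_1_l; apply Hp.
  - replace 0 with ((RInt P 0 (2 * PI) : R) - (2 * PI - 0) * mu) at 2.
    + apply (is_RInt_minus (V := R_NormedModule)).
      * apply (RInt_correct (V := R_CompleteNormedModule)).
        apply (ex_RInt_continuous (V := R_CompleteNormedModule)); intros; apply HPc.
      * apply (is_RInt_const (V := R_NormedModule)).
    + unfold mu; field; lra.
  - intros t. replace (psi t) with (psi t - 0) by ring.
    apply (is_derive_minus (V := R_NormedModule)); [apply HP|].
    apply (is_derive_const (V := R_NormedModule)).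
Qed.

(** Integration by parts [m] times. [B] is fixed before [om] and [U], because later [U] depends on
    [om] through the nodes. Endpoint derivatives may grow like [om ^ j], which the gain of one
    factor [/ om] per step exactly absorbs; in the interior only the order [m] is constrained. The
    induction runs over all [psi], since each step replaces [psi] by its antiderivative. *)
Lemma oscillatory_integral_bound (a b : R) (m : nat) : a < b ->
  forall psi, zero_mean_periodic psi ->
  exists B, 0 <= B /\ forall om A1 A2 (U : nat -> R -> R), 1 <= om -> 0 <= A1 -> 0 <= A2 ->
    (forall j t, a <= t <= b -> is_derive (U j) t (U (S j) t)) ->
    (forall j, (j < m)%nat -> Rabs (U j a) <= A1 * om ^ j /\ Rabs (U j b) <= A1 * om ^ j) ->
    (forall t, a <= t <= b -> Rabs (U m t) <= A2 * om ^ m) ->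
    Rabs (RInt (fun t => U 0%nat t * psi (om * t)) a b) <= B * (A1 / om + A2).
Proof.
  intros Hab.
  assert (Hcom : forall (f : R -> R) (om : R), (forall t, continuous f t) -> forall t : R, continuous (fun t => f (om * t)) t).
  { intros f om Hf t; apply (continuous_comp (fun t => om * t) f); [|apply Hf].
    apply (continuous_mult (K := R_AbsRing)); [apply continuous_const|apply continuous_id]. }
  assert (HcU : forall (U : nat -> R -> R), (forall j t, a <= t <= b -> is_derive (U j) t (U (S j) t)) ->
    forall j t, a <= t <= b -> continuous (U j) t).
  { intros U HU j t Ht; apply (ex_derive_continuous (K := R_AbsRing) (V := R_NormedModule)).
    eexists; apply HU, Ht. }
  induction m as [|m IH]; intros psi Hpsi.
  - destruct (periodic_bounded psi) as [B [HB Hb]]; try apply Hpsi.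
    exists ((b - a) * B); split; [apply Rmult_le_pos; lra|].
    intros om A1 A2 U Hom HA1 HA2 HU _ Hmid.
    apply Rle_trans with ((b - a) * (A2 * B)).
    + apply abs_RInt_le_const; [lra| |].
      * apply (ex_RInt_continuous (V := R_CompleteNormedModule)); intros t Ht.
        rewrite Rmin_left, Rmax_right in Ht by lra.
        apply (continuous_mult (K := R_AbsRing)); [apply (HcU U HU 0%nat t Ht)|].
        apply Hcom, Hpsi.
      * intros t Ht; rewrite Rabs_mult. specialize (Hmid t Ht); simpl in Hmid.
        rewrite Rmult_1_r in Hmid. apply Rmult_le_compat; trivial; apply Rabs_pos.
    + assert (0 <= A1 / om) by (apply Rle_mult_inv_pos; lra).
      assert (0 <= (b - a) * B) by (apply Rmult_le_pos; lra).
      nra.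
  - destruct (zero_mean_antiderivative psi Hpsi) as [Psi [HPsi HD]].
    destruct (periodic_bounded Psi) as [B0 [HB0 Hb0]]; try apply HPsi.
    destruct (IH Psi HPsi) as [B [HB Hb]].
    exists (B + 2 * B0); split; [lra|].
    intros om A1 A2 U Hom HA1 HA2 HU Hends Hmid.
    set (J := RInt (fun t => U 1%nat t * Psi (om * t)) a b : R).
    assert (HJ : is_RInt (fun t => U 1%nat t * Psi (om * t)) a b J).
    { apply (RInt_correct (V := R_CompleteNormedModule)).
      apply (ex_RInt_continuous (V := R_CompleteNormedModule)); intros t Ht.
      rewrite Rmin_left, Rmax_right in Ht by lra.
      apply (continuous_mult (K := R_AbsRing)); [apply (HcU U HU 1%nat t Ht)|].
      apply Hcom, HPsi. }
    assert (HP : is_RInt (fun t => U 1%nat t * Psi (om * t) + U 0%nat t * (om * psi (om * t))) a b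
      (U 0%nat b * Psi (om * b) - U 0%nat a * Psi (om * a))).
    { apply (is_RInt_derive (V := R_CompleteNormedModule) (fun t => U 0%nat t * Psi (om * t)));
        intros t Ht; rewrite Rmin_left, Rmax_right in Ht by lra.
      - apply (is_derive_mult (U 0%nat) (fun t => Psi (om * t)) t); [apply HU, Ht| |exact Rmult_comm].
        apply (is_derive_comp Psi (fun t => om * t)); [apply HD|].
        auto_derive; trivial; ring.
      - apply (continuous_plus (V := R_NormedModule));
        apply (continuous_mult (K := R_AbsRing)).
        + apply (HcU U HU 1%nat t Ht).
        + apply Hcom, HPsi.
        + apply (HcU U HU 0%nat t Ht).
        + apply (continuous_mult (K := R_AbsRing)); [apply continuous_const|].
          apply Hcom, Hpsi. }
    assert (HI : is_RInt (fun t => U 0%nat t * psi (om * t)) a b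
      (/ om * (U 0%nat b * Psi (om * b) - U 0%nat a * Psi (om * a) - J))).
    { eapply (is_RInt_ext (V := R_NormedModule));
        [|apply (is_RInt_scal (V := R_NormedModule) _ _ _ (/ om) _
            (is_RInt_minus (V := R_NormedModule) _ _ _ _ _ _ HP HJ))].
      intros t _; unfold scal, minus, plus, opp; simpl; unfold mult; simpl.
      match goal with |- ?l = ?r => change (@eq R l r) end; field; lra. }
    rewrite (is_RInt_unique (V := R_CompleteNormedModule) _ _ _ _ HI).
    assert (Hiom : 0 < / om) by (apply Rinv_0_lt_compat; lra).
    (* Shifting the chain [U] by one order multiplies both [A1] and [A2] by [om]; the prefactor
       [/ om] from this step undoes it, and the two boundary terms contribute
       [2 * B0 * (A1 / om)]. *)
    assert (HJb : Rabs J <= B * (A1 * om / om + A2 * om)).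
    { apply (Hb om (A1 * om) (A2 * om) (fun j => U (S j))); trivial.
      - apply Rmult_le_pos; lra.
      - apply Rmult_le_pos; lra.
      - intros; apply HU; trivial.
      - intros j Hj. destruct (Hends (S j) ltac:(lia)) as [H1 H2]; simpl in H1, H2.
        rewrite !Rmult_assoc; split; trivial.
      - intros t Ht; rewrite !Rmult_assoc; apply (Hmid t Ht). }
    destruct (Hends 0%nat ltac:(lia)) as [Ha Hb']; simpl in Ha, Hb'; rewrite Rmult_1_r in Ha, Hb'.
    rewrite Rabs_mult, (Rabs_pos_eq (/ om)) by lra.
    assert (HE : Rabs (U 0%nat b * Psi (om * b) - U 0%nat a * Psi (om * a) - J)
      <= 2 * (A1 * B0) + B * (A1 * om / om + A2 * om)).
    { unfold Rminus. eapply Rle_trans; [apply Rabs_triang|]; rewrite Rabs_Ropp.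
      apply Rplus_le_compat; trivial.
      eapply Rle_trans; [apply Rabs_triang|]; rewrite Rabs_Ropp, !Rabs_mult.
      assert (Rabs (U 0%nat b) * Rabs (Psi (om * b)) <= A1 * B0)
        by (apply Rmult_le_compat; auto using Rabs_pos).
      assert (Rabs (U 0%nat a) * Rabs (Psi (om * a)) <= A1 * B0)
        by (apply Rmult_le_compat; auto using Rabs_pos).
      lra. }
    eapply Rle_trans; [apply Rmult_le_compat_l; [lra|exact HE]|].
    replace (/ om * (2 * (A1 * B0) + B * (A1 * om / om + A2 * om)))
      with (B * (A1 / om + A2) + 2 * B0 * (A1 / om)) by (field; lra).
    nra.
Qed.

(** * Divided differences and Newton interpolation *)

Lemma cdiff_ext_loc (F G : C -> C) (z : C) (d : R) : 0 < d ->
  (forall w, Cmod (w - z) < d -> F w = G w) -> cdiff F z -> cdiff G z.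
Proof.
  intros Hd H [l Hl]; exists l; intros eps Heps; destruct (Hl eps Heps) as [e [He Hw]].
  exists (Rmin d e); split; [apply Rmin_pos; trivial|]; intros w Hwz.
  assert (Cmod (w - z) < d) by (eapply Rlt_le_trans; [exact Hwz|apply Rmin_l]).
  assert (Cmod (w - z) < e) by (eapply Rlt_le_trans; [exact Hwz|apply Rmin_r]).
  assert (Hzz : Cmod (z - z) < d).
  { replace (z - z)%C with (RtoC 0) by ring; rewrite Cmod_0; trivial. }
  rewrite <- (H w H0), <- (H z Hzz); auto.
Qed.

Lemma cdiff_quotient (F : C -> C) (zeta z : C) : z <> zeta -> cdiff F z ->
  cdiff (fun w => (F w - F zeta) / (w - zeta))%C z.
Proof.
  intros Hz [l Hl].
  set (q := ((F z - F zeta) / (z - zeta))%C).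
  set (e := Cmod (z - zeta)).
  assert (Hnz : forall u v : C, u <> v -> (u - v)%C <> 0%C).
  { intros u v H H0; apply H; replace u with (u - v + v)%C by ring; rewrite H0; ring. }
  assert (He : 0 < e) by (apply Cmod_gt_0, Hnz, Hz).
  exists ((l - q) / (z - zeta))%C; intros eps Heps.
  destruct (Hl (eps * e / 4)) as [d [Hd Hw]]; [nra|].
  pose proof (Cmod_ge_0 (l - q)) as Hlq.
  set (K := Cmod (l - q) + 1).
  (* The three radii control the remainder of [F], keep [w] at distance at least [e / 2] from
     [zeta], and bound the error (l - q) (w - z)^2 / ((w - zeta) (z - zeta)) of replacing w - zeta
     by z - zeta. *)
  exists (Rmin d (Rmin (e / 2) (eps * e ^ 2 / (4 * K)))); split.
  { repeat apply Rmin_pos; trivial; [lra|]. apply Rdiv_lt_0_compat; [|unfold K; lra].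
    apply Rmult_lt_0_compat; [|apply pow_lt]; lra. }
  intros w Hwz.
  assert (H1 : Cmod (w - z) < d) by (eapply Rlt_le_trans; [exact Hwz|apply Rmin_l]).
  assert (H23 : Cmod (w - z) < Rmin (e / 2) (eps * e ^ 2 / (4 * K)))
    by (eapply Rlt_le_trans; [exact Hwz|apply Rmin_r]).
  assert (H2 : Cmod (w - z) < e / 2) by (eapply Rlt_le_trans; [exact H23|apply Rmin_l]).
  assert (H3 : Cmod (w - z) < eps * e ^ 2 / (4 * K)) by (eapply Rlt_le_trans; [exact H23|apply Rmin_r]).
  assert (Hwe : e / 2 <= Cmod (w - zeta)).
  { replace (w - zeta)%C with ((z - zeta) - (z - w))%C by ring.
    eapply Rle_trans; [|apply Cmod_minus_ge]. fold e.
    replace (z - w)%C with (- (w - z))%C by ring. rewrite Cmod_opp; lra. }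
  assert (Hwn : (w - zeta)%C <> 0%C) by (apply Cmod_gt_0; lra).
  assert (Hzn : (z - zeta)%C <> 0%C) by (apply Hnz, Hz).
  set (rem := (F w - F z - l * (w - z))%C) in *.
  specialize (Hw w H1). fold rem in Hw.
  replace ((F w - F zeta) / (w - zeta) - (F z - F zeta) / (z - zeta) - (l - q) / (z - zeta) * (w - z))%C
    with (rem / (w - zeta) - (l - q) * (w - z) * (w - z) / ((w - zeta) * (z - zeta)))%C
    by (unfold rem, q; field; auto).
  eapply Rle_trans; [apply Cmod_minus_le|].
  rewrite !Cmod_div by (trivial; apply Cmod_gt_0; rewrite Cmod_mult; apply Rmult_lt_0_compat; apply Cmod_gt_0; trivial).
  rewrite !Cmod_mult. fold e.
  pose proof (Cmod_ge_0 (w - z)) as Hc0.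
  set (dd := Cmod (w - z)) in *. set (W := Cmod (w - zeta)) in *.
  assert (HW : / W <= 2 / e).
  { replace (2 / e) with (/ (e / 2)) by (field; lra). apply Rinv_le_contravar; lra. }
  assert (HW0 : 0 < / W) by (apply Rinv_0_lt_compat; lra).
  assert (HA : Cmod rem / W <= eps / 2 * dd).
  { unfold Rdiv at 1.
    apply Rle_trans with (eps * e / 4 * dd * (2 / e)).
    - apply Rmult_le_compat; trivial; [apply Cmod_ge_0|lra].
    - right; field; lra. }
  assert (HB : Cmod (l - q) * dd * dd / (W * e) <= eps / 2 * dd).
  { replace (Cmod (l - q) * dd * dd / (W * e)) with (dd * (Cmod (l - q) * dd) * / e * / W) by (field; lra).
    assert (Hkd : Cmod (l - q) * dd <= eps * e ^ 2 / 4).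
    { apply Rle_trans with (K * (eps * e ^ 2 / (4 * K))).
      - apply Rmult_le_compat; trivial; [unfold K|]; lra.
      - right; field; unfold K; lra. }
    assert (Hie : 0 < / e) by (apply Rinv_0_lt_compat, He).
    assert (H0 : 0 <= Cmod (l - q) * dd) by (apply Rmult_le_pos; trivial).
    apply Rle_trans with (dd * (eps * e ^ 2 / 4) * / e * (2 / e)).
    - apply Rmult_le_compat; try lra.
      + repeat apply Rmult_le_pos; lra.
      + apply Rmult_le_compat_r; [lra|]. apply Rmult_le_compat_l; trivial.
    - right; field; lra. }
  lra.
Qed.

(** The quotient is completed at [zeta] by the Taylor coefficient [a 1]. For |z - zeta| <= rho/2 the
    series bounds it; farther away the numerator is at most 2M and the denominator at least rho/2,
    whence the constant [4 / rho], independent of [zeta]. The final identity holds for all [z], also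
    outside [V]. *)
Lemma divided_difference (F : C -> C) (V : C -> Prop) (zeta : C) (rho M : R) :
  0 < rho ->
  (forall z, V z -> cdiff F z) -> (forall z, V z -> Cmod (F z) <= M) ->
  (forall z, Cmod (z - zeta) < 2 * rho -> V z) ->
  exists F1 : C -> C, (forall z, V z -> cdiff F1 z) /\
    (forall z, V z -> Cmod (F1 z) <= 4 / rho * M) /\
    forall z, F z = (F zeta + (z - zeta) * F1 z)%C.
Proof.
  intros Hrho HF HM HV.
  assert (HM0 : 0 <= M).
  { apply Rle_trans with (Cmod (F zeta)); [apply Cmod_ge_0|apply HM, HV].
    replace (zeta - zeta)%C with (RtoC 0) by ring; rewrite Cmod_0; lra. }
  destruct (taylor F zeta (2 * rho) rho M) as [a [Ha Hser]]; [lra| | |].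
  { intros z Hz; apply HF, HV, Hz. }
  { intros t; apply HM, HV; rewrite Cmod_circle; lra. }
  assert (Hnz : forall u v : C, u <> v -> (u - v)%C <> 0%C).
  { intros u v H H0; apply H; replace u with (u - v + v)%C by ring; rewrite H0; ring. }
  assert (Ha0 : a 0%nat = F zeta).
  { pose proof (Hser zeta 1%nat) as H.
    replace (zeta - zeta)%C with (RtoC 0) in H by ring; rewrite Cmod_0 in H.
    specialize (H Hrho). unfold Csum in H; simpl in H.
    unfold Rdiv in H; rewrite !Rmult_0_l, Rmult_0_r in H.
    assert (H0 : Cmod (F zeta - (a 0%nat * 1 + 0)) = 0).
    { apply Rle_antisym; [exact H|apply Cmod_ge_0]. }
    apply Cmod_eq_0 in H0.
    replace (F zeta) with (F zeta - (a 0%nat * 1 + 0) + a 0%nat)%C by ring. rewrite H0; ring. }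
  set (F1 z := if Ceq_dec z zeta then a 1%nat else ((F z - F zeta) / (z - zeta))%C).
  assert (Hser1 : forall z n, z <> zeta -> Cmod (z - zeta) <= rho / 2 ->
    Cmod (F1 z - Csum n (fun k => a (S k) * (z - zeta) ^ k)%C)
      <= 2 / rho * M * (Cmod (z - zeta) / rho) ^ n).
  { intros z n Hz Hzr. unfold F1; destruct Ceq_dec as [?|_]; [contradiction|].
    pose proof (Hser z (S n) ltac:(lra)) as H.
    assert (Hc : 0 < Cmod (z - zeta)) by (apply Cmod_gt_0, Hnz, Hz).
    rewrite Csum_S_l, Ha0 in H.
    rewrite (Csum_ext n _ (fun k => (z - zeta) * (a (S k) * (z - zeta) ^ k))%C) in H
      by (intros; simpl; ring).
    rewrite Csum_mult_l in H.
    set (S1 := Csum n (fun k => a (S k) * (z - zeta) ^ k)%C) in *.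
    replace (F z - (F zeta * (z - zeta) ^ 0 + (z - zeta) * S1))%C
      with ((z - zeta) * ((F z - F zeta) / (z - zeta) - S1))%C in H
      by (simpl; field; apply Hnz, Hz).
    rewrite Cmod_mult in H.
    apply (Rmult_le_reg_l (Cmod (z - zeta))); trivial.
    eapply Rle_trans; [exact H|]. set (x := Cmod (z - zeta)) in *.
    assert (Hq : 0 <= (x / rho) ^ n) by (apply pow_le, Rle_mult_inv_pos; lra).
    replace (x * (2 / rho * M * (x / rho) ^ n)) with (M * ((x / rho) ^ S n * 2))
      by (simpl; field; lra).
    apply Rmult_le_compat_l; trivial. apply Rmult_le_compat_l.
    - apply pow_le, Rle_mult_inv_pos; lra.
    - apply (Rmult_le_reg_r (rho - x)); [lra|].
      replace (rho / (rho - x) * (rho - x)) with rho by (field; lra). lra. }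
  exists F1; split; [|split].
  - intros z Hz. destruct (Ceq_dec z zeta) as [->|Hne].
    (* The estimate [Hser1] with two terms has a quadratic remainder, so [a 2] is the derivative of
       [F1] at [zeta]. *)
    + exists (a 2%nat); intros eps Heps.
      exists (Rmin (rho / 2) (eps / (2 / rho * M / rho ^ 2 + 1))).
      assert (HK : 0 <= 2 / rho * M / rho ^ 2).
      { repeat apply Rmult_le_pos; try lra; try (left; apply Rinv_0_lt_compat; try apply pow_lt; lra). }
      split; [apply Rmin_pos; [lra|apply Rdiv_lt_0_compat; lra]|].
      intros w Hw.
      assert (H1 : Cmod (w - zeta) < rho / 2) by (eapply Rlt_le_trans; [exact Hw|apply Rmin_l]).
      assert (H2 : Cmod (w - zeta) < eps / (2 / rho * M / rho ^ 2 + 1))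
        by (eapply Rlt_le_trans; [exact Hw|apply Rmin_r]).
      destruct (Ceq_dec w zeta) as [->|Hwn].
      * replace (F1 zeta - F1 zeta - a 2%nat * (zeta - zeta))%C with (RtoC 0) by ring.
        rewrite Cmod_0. apply Rmult_le_pos; [lra|apply Cmod_ge_0].
      * pose proof (Hser1 w 2%nat Hwn ltac:(lra)) as H.
        replace (F1 zeta) with (a 1%nat)
          by (unfold F1; destruct Ceq_dec; [reflexivity|contradiction]).
        replace (F1 w - a 1%nat - a 2%nat * (w - zeta))%C
          with (F1 w - Csum 2 (fun k => a (S k) * (w - zeta) ^ k)%C)%C
          by (unfold Csum; simpl; ring).
        eapply Rle_trans; [exact H|].
        pose proof (Cmod_ge_0 (w - zeta)) as Hx0. set (x := Cmod (w - zeta)) in *.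
        replace (2 / rho * M * (x / rho) ^ 2) with (2 / rho * M / rho ^ 2 * x * x) by (field; lra).
        apply Rmult_le_compat_r; trivial.
        set (K := 2 / rho * M / rho ^ 2) in *.
        apply (Rmult_lt_compat_r (K + 1)) in H2; [|lra].
        replace (eps / (K + 1) * (K + 1)) with eps in H2 by (field; lra). nra.
    + assert (Hc : 0 < Cmod (z - zeta)) by (apply Cmod_gt_0, Hnz, Hne).
      apply (cdiff_ext_loc (fun w => (F w - F zeta) / (w - zeta))%C F1 z (Cmod (z - zeta)) Hc).
      * intros w Hw; unfold F1; destruct Ceq_dec as [->|_]; [|reflexivity].
        exfalso. replace (zeta - z)%C with (- (z - zeta))%C in Hw by ring.
        rewrite Cmod_opp in Hw; lra.
      * apply cdiff_quotient; [exact Hne|apply HF, Hz].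
  - intros z Hz. destruct (Ceq_dec z zeta) as [Heq|Hne].
    + unfold F1; destruct Ceq_dec; [|contradiction].
      eapply Rle_trans; [apply Ha|]. simpl; rewrite Rmult_1_r; unfold Rdiv.
      assert (0 < / rho) by (apply Rinv_0_lt_compat; lra). nra.
    + destruct (Rle_dec (Cmod (z - zeta)) (rho / 2)) as [Hle|Hgt].
      * pose proof (Hser1 z 0%nat Hne Hle) as H. unfold Csum in H; simpl in H.
        replace (F1 z - 0)%C with (F1 z) in H by ring.
        assert (0 < / rho) by (apply Rinv_0_lt_compat; lra).
        assert (0 <= / rho * M) by (apply Rmult_le_pos; lra). unfold Rdiv in *; nra.
      * unfold F1; destruct Ceq_dec; [contradiction|].
        rewrite Cmod_div by (apply Hnz, Hne).
        assert (Cmod (F z - F zeta) <= 2 * M).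
        { eapply Rle_trans; [apply Cmod_minus_le|].
          assert (Cmod (F zeta) <= M).
          { apply HM, HV. replace (zeta - zeta)%C with (RtoC 0) by ring; rewrite Cmod_0; lra. }
          specialize (HM z Hz); lra. }
        replace (4 / rho * M) with (2 * M * / (rho / 2)) by (field; lra).
        apply Rmult_le_compat; trivial; [apply Cmod_ge_0| |].
        -- left; apply Rinv_0_lt_compat; lra.
        -- apply Rinv_le_contravar; lra.
  - intros z. unfold F1; destruct Ceq_dec as [->|Hne]; [ring|].
    field; apply Hnz, Hne.
Qed.

(** Peeling off one node at a time by divided differences allows repeated nodes, hence Hermite
    interpolation, and never divides by a difference of two nodes; the bound on [h] therefore
    survives nodes that coalesce. *)
Lemma newton_interpolation (V : C -> Prop) (rho : R) (l : list C) : 0 < rho ->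
  (forall zeta z, In zeta l -> Cmod (z - zeta) < 2 * rho -> V z) ->
  forall (F : C -> C) (M : R),
  (forall z, V z -> cdiff F z) -> (forall z, V z -> Cmod (F z) <= M) ->
  exists (c : nat -> C) (h : C -> C),
    (forall i, (length l <= i)%nat -> c i = 0%C) /\
    (forall z, V z -> cdiff h z) /\
    (forall z, V z -> Cmod (h z) <= (4 / rho) ^ length l * M) /\
    forall z, F z = (Csum (length l) (fun i => c i * z ^ i)
      + fold_right Cmult 1 (map (fun zeta => z - zeta) l) * h z)%C.
Proof.
  intros Hrho; induction l as [|zeta l IH]; intros Hl F M HF HM.
  - exists (fun _ => RtoC 0), F; split; [|split; [|split]]; trivial; simpl.
    + intros; rewrite Rmult_1_l; auto.
    + intros; unfold Csum; simpl; ring.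
  - destruct (divided_difference F V zeta rho M Hrho HF HM) as (F1 & H1 & H2 & H3).
    { intros z; apply Hl; left; reflexivity. }
    destruct (IH (fun z w Hz => Hl z w (or_intror Hz)) F1 _ H1 H2) as (c & h & Hc & Hh1 & Hh2 & Hh3).
    (* The coefficients of F(zeta) + (z - zeta) p(z), where p is the interpolant of the divided
       difference at the remaining nodes. *)
    exists (fun i => match i with
      | O => F zeta - zeta * c 0%nat
      | S j => c j - zeta * c (S j) end)%C, h.
    split; [|split; [|split]]; trivial.
    + intros [|i] Hi; simpl in Hi; [lia|]. rewrite !Hc by lia; ring.
    + intros z Hz; eapply Rle_trans; [apply Hh2, Hz|]; simpl; right; ring.
    + intros z; rewrite H3, Hh3; simpl length; simpl map; simpl fold_right.
      rewrite Csum_S_l.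
      assert (Hshift : Csum (length l) (fun k => (c k - zeta * c (S k)) * z ^ S k)%C
        = (z * Csum (length l) (fun k => c k * z ^ k)
           + - zeta * Csum (length l) (fun k => c (S k) * z ^ S k))%C).
      { rewrite <- !Csum_mult_l, <- Csum_plus. apply Csum_ext; intros; simpl; ring. }
      rewrite Hshift.
      (* As the coefficient of index [length l] is zero, the sum for p may be given one more term
         and its constant term split off, which matches the shifted sum. *)
      pose proof (Csum_S_l (length l) (fun i => c i * z ^ i)%C) as Hs.
      rewrite Csum_S, (Hc (length l)) in Hs by lia.
      rewrite Cmult_0_l, Cplus_0_r in Hs.
      rewrite Hs. generalize (Csum (length l) (fun k => c (S k) * z ^ S k)%C); intros X.
      simpl Cpow. ring.
Qed.

(** * Error of the Gaussian rule *)

Lemma Cmod_le_abs (z : C) : Cmod z <= Rabs (fst z) + Rabs (snd z).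
Proof.
  replace z with (RtoC (fst z) + Ci * RtoC (snd z))%C at 1
    by (destruct z; unfold RtoC, Ci, Cplus, Cmult; simpl; f_equal; ring).
  eapply Rle_trans; [apply Cmod_triangle|].
  rewrite Cmod_mult, Cmod_Ci, !Cmod_R; lra.
Qed.

Lemma segment_neighborhood (a b : R) (F : C -> C) (U : C -> Prop) : a <= b ->
  open U -> (forall t, a <= t <= b -> U (RtoC t)) -> (forall z, U z -> cdiff F z) ->
  exists d M, 0 < d /\ forall t z, a <= t <= b -> Cmod (z - RtoC t) < d -> U z /\ Cmod (F z) <= M.
Proof.
  intros Hab HU Ht HF.
  (* The radius [d] is kept below [1 / (|F t| + 1)], so that the Lebesgue number of the
     covering yields the bound on [F] as well. *)
  assert (Hloc : forall t, exists d : posreal, a <= t <= b ->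
    forall z, Cmod (z - RtoC t) < 2 * d -> U z /\ Cmod (F z) <= / d).
  { intros t. destruct (classic (a <= t <= b)) as [Hab'|Hn].
    - destruct (HU _ (Ht t Hab')) as [e1 He1].
      destruct (cdiff_eps F t (HF _ (Ht t Hab')) 1 Rlt_0_1) as [e2 [He2 Hw]].
      pose proof (Cmod_ge_0 (F t)) as HFt.
      assert (Hi : 0 < / (Cmod (F t) + 1)) by (apply Rinv_0_lt_compat; lra).
      assert (Hd : 0 < Rmin (Rmin e1 e2 / 2) (/ (Cmod (F t) + 1))).
      { repeat apply Rmin_pos; trivial. apply Rdiv_lt_0_compat; [|lra].
        apply Rmin_pos; trivial; apply cond_pos. }
      exists (mkposreal _ Hd); intros _ z Hz; simpl in *.
      set (d := Rmin (Rmin e1 e2 / 2) (/ (Cmod (F t) + 1))) in *.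
      assert (H1 : d <= Rmin e1 e2 / 2) by apply Rmin_l.
      assert (H2 : d <= / (Cmod (F t) + 1)) by apply Rmin_r.
      assert (H3 : Rmin e1 e2 <= e1) by apply Rmin_l.
      assert (H4 : Rmin e1 e2 <= e2) by apply Rmin_r.
      split.
      + apply He1, C_NormedModule_mixin_compat1.
        change (Cmod (z - RtoC t) < e1); lra.
      + apply Rle_trans with (Cmod (F t) + 1).
        * specialize (Hw z ltac:(lra)).
          replace (F z) with ((F z - F t) + F t)%C by ring.
          eapply Rle_trans; [apply Cmod_triangle|lra].
        * rewrite <- (Rinv_inv (Cmod (F t) + 1)). apply Rinv_le_contravar; trivial.
    - exists (mkposreal 1 Rlt_0_1); intros H; contradiction. }
  set (delta t := proj1_sig (constructive_indefinite_description _ (Hloc t))).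
  assert (Hdelta : forall t, a <= t <= b ->
    forall z, Cmod (z - RtoC t) < 2 * delta t -> U z /\ Cmod (F z) <= / delta t).
  { intros t; unfold delta; destruct constructive_indefinite_description as [d Hd]; exact Hd. }
  destruct (compactness_value_1d a b delta) as [d Hd].
  exists d, (/ d); split; [apply cond_pos|].
  intros t z Htab Hz.
  destruct (NNPP _ (Hd t Htab)) as (t' & Ht' & Htt & Hdt).
  pose proof (cond_pos d) as Hd0.
  destruct (Hdelta t' Ht' z) as [H1 H2].
  - replace (z - RtoC t')%C with ((z - RtoC t) + RtoC (t - t'))%C by (rewrite RtoC_minus; ring).
    eapply Rle_lt_trans; [apply Cmod_triangle|]. rewrite Cmod_R; lra.
  - split; trivial. eapply Rle_trans; [exact H2|]. apply Rinv_le_contravar; trivial.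
Qed.

(** [g] is tied to [G] only on [-1,1], so [u], the real part of [G] on the real line, takes its
    place in [mean_value]. The range of [phi] lies in [-1,1], and the derivatives at 0 see only a
    neighbourhood of 0, so neither the weight nor [rho0] changes. *)
Lemma zero_mean_osc_weight (g : R -> R) (s : bool) :
  (exists r, 1 < r /\ exists G : C -> C,
      (forall z, Cmod z < r -> holo_at G z) /\
      (forall t, -1 <= t <= 1 -> G (RtoC t) = RtoC (g t))) ->
  zero_mean_periodic (fun t => g (phi s 1 t) - rho0 g / 2).
Proof.
  intros (r & Hr & G & HG & HGg).
  assert (HGd : forall z, Cmod z < r -> cdiff G z) by (intros; apply holo_at_cdiff, HG; trivial).
  set (u t := fst (G (RtoC t))).
  assert (Hug : forall t, -1 <= t <= 1 -> g t = u t) by (intros; unfold u; rewrite HGg by trivial; reflexivity).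
  assert (Hcu : forall t, continuous (fun t => u (phi s 1 t)) t).
  { intros t; unfold u; apply continuous_fst_comp.
    apply (continuous_comp (fun t => RtoC (phi s 1 t)) G).
    - apply continuous_RtoC, continuous_phi.
    - apply cdiff_continuous, HGd. rewrite Cmod_R.
      pose proof (phi_bound s t). apply Rle_lt_trans with 1; trivial. apply Rabs_le; lra. }
  set (rho := (1 + r) / 2).
  assert (Hrho : 1 < rho < r) by (unfold rho; lra).
  assert (Hcirc : forall t, ccont (fun t => G (RtoC rho * cis t)%C) t).
  { intros t; apply (continuous_comp (fun t => RtoC rho * cis t)%C G).
    - apply continuous_Cmult; [apply continuous_const|apply continuous_cis].
    - apply cdiff_continuous, HGd. rewrite Cmod_mult, Cmod_R, Cmod_cis, Rabs_pos_eq; lra. }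
  assert (Hper : forall t, cis (t + 2 * PI) = cis t).
  { intros t; unfold cis; f_equal; [rewrite <- (cos_period t 1)|rewrite <- (sin_period t 1)];
    f_equal; simpl; ring. }
  destruct (periodic_bounded (fun t => fst (G (RtoC rho * cis t)%C))) as [B1 [HB1 Hb1]].
  { intros t; apply continuous_fst_comp, Hcirc. }
  { intros t; rewrite Hper; reflexivity. }
  destruct (periodic_bounded (fun t => snd (G (RtoC rho * cis t)%C))) as [B2 [HB2 Hb2]].
  { intros t; apply continuous_snd_comp, Hcirc. }
  { intros t; rewrite Hper; reflexivity. }
  destruct (taylor_real G 0 r rho (B1 + B2)) as [[b Hb] _].
  { lra. }
  { intros z Hz; apply HGd. replace z with (z - 0)%C by ring; exact Hz. }
  { intros t; rewrite Cplus_0_l. eapply Rle_trans; [apply Cmod_le_abs|].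
    specialize (Hb1 t); specialize (Hb2 t); lra. }
  pose proof (mean_value u s rho (B1 + B2) b ltac:(lra) ltac:(lra) Hb Hcu) as HI.
  assert (Hrho0 : rho0 u = rho0 g).
  { unfold rho0; f_equal; apply Series_ext; intros k; f_equal.
    apply Derive_n_ext_loc. exists (mkposreal 1 Rlt_0_1); intros y Hy.
    symmetry; apply Hug.
    change (Rabs (y - 0) < 1) in Hy. apply Rabs_lt_between in Hy; lra. }
  rewrite Hrho0 in HI.
  assert (Hg : forall t, g (phi s 1 t) = u (phi s 1 t)) by (intros; apply Hug, phi_bound).
  split; [|split].
  - intros t; apply (continuous_minus (V := R_NormedModule)); [|apply continuous_const].
    apply (continuous_ext (fun t => u (phi s 1 t))); [intros; symmetry; apply Hg|apply Hcu].
  - intros t; rewrite phi_period; reflexivity.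
  - replace 0 with (2 * PI * (rho0 g / 2) - (2 * PI - 0) * (rho0 g / 2)) at 2 by ring.
    apply (is_RInt_minus (V := R_NormedModule)); [|apply (is_RInt_const (V := R_NormedModule))].
    apply (is_RInt_ext (V := R_NormedModule) (fun t => u (phi s 1 t))); [intros; symmetry; apply Hg|exact HI].
Qed.

Lemma cdiff_mult_linear (F : C -> C) (zeta z : C) : cdiff F z -> cdiff (fun w => (w - zeta) * F w)%C z.
Proof.
  intros HF; pose proof (cdiff_eps F z HF) as Hc; destruct HF as [l Hl].
  exists (F z + (z - zeta) * l)%C; intros eps Heps.
  set (e := Cmod (z - zeta) + 1). pose proof (Cmod_ge_0 (z - zeta)) as He.
  destruct (Hc (eps / 2) ltac:(lra)) as [d1 [Hd1 Hw1]].
  destruct (Hl (eps / (2 * e))) as [d2 [Hd2 Hw2]]; [apply Rdiv_lt_0_compat; unfold e; lra|].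
  exists (Rmin d1 d2); split; [apply Rmin_pos; trivial|]; intros w Hw.
  specialize (Hw1 w (Rlt_le_trans _ _ _ Hw (Rmin_l _ _))).
  specialize (Hw2 w (Rlt_le_trans _ _ _ Hw (Rmin_r _ _))).
  replace ((w - zeta) * F w - (z - zeta) * F z - (F z + (z - zeta) * l) * (w - z))%C
    with ((w - z) * (F w - F z) + (z - zeta) * (F w - F z - l * (w - z)))%C by ring.
  eapply Rle_trans; [apply Cmod_triangle|]; rewrite !Cmod_mult.
  pose proof (Cmod_ge_0 (w - z)) as Hx.
  assert (H1 : Cmod (w - z) * Cmod (F w - F z) <= Cmod (w - z) * (eps / 2))
    by (apply Rmult_le_compat_l; lra).
  assert (H2 : Cmod (z - zeta) * Cmod (F w - F z - l * (w - z)) <= e * (eps / (2 * e) * Cmod (w - z))).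
  { apply Rmult_le_compat; trivial; [apply Cmod_ge_0|unfold e; lra]. }
  replace (e * (eps / (2 * e) * Cmod (w - z))) with (eps / 2 * Cmod (w - z)) in H2
    by (field; unfold e; lra).
  lra.
Qed.

Lemma cdiff_linear_factors (F : C -> C) (z : C) (l : list C) : cdiff F z ->
  cdiff (fun w => fold_right Cmult 1 (map (fun zeta => w - zeta) l) * F w)%C z.
Proof.
  intros HF; induction l as [|zeta l IH]; simpl.
  - apply (cdiff_ext_loc F _ z 1 Rlt_0_1); trivial; intros; ring.
  - apply (cdiff_ext_loc (fun w => (w - zeta) * (fold_right Cmult 1 (map (fun zeta => w - zeta) l) * F w))%C
      _ z 1 Rlt_0_1); [intros; ring|].
    apply cdiff_mult_linear, IH.
Qed.

Lemma Cprod_S (n : nat) (u : nat -> C) : Cprod (S n) u = (Cprod n u * u n)%C.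
Proof.
  unfold Cprod; rewrite seq_S, map_app, fold_right_app; simpl.
  generalize (map u (seq 0 n)) as l; intros l; induction l as [|x l IH]; simpl.
  - ring.
  - rewrite IH; ring.
Qed.

Lemma Cprod_eq_0 (n k : nat) (u : nat -> C) : (k < n)%nat -> u k = 0%C -> Cprod n u = 0%C.
Proof.
  intros Hk Hu; induction n as [|n IH]; [lia|]; rewrite Cprod_S.
  destruct (Nat.eq_dec k n) as [->|Hne]; [rewrite Hu; ring|rewrite IH by lia; ring].
Qed.

Lemma Cmod_Cprod_le (m p : nat) (u : nat -> C) (A B : R) : 0 <= A -> 0 <= B ->
  (forall k, (k < m)%nat -> Cmod (u k) <= A) ->
  (forall k, (m <= k < m + p)%nat -> Cmod (u k) <= B) ->
  Cmod (Cprod (m + p) u) <= A ^ m * B ^ p.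
Proof.
  intros HA HB HuA; induction p as [|p IHp]; intros HuB.
  - rewrite Nat.add_0_r, Rmult_1_r; clear HuB. induction m as [|m IHm].
    + unfold Cprod; simpl; rewrite Cmod_1; lra.
    + rewrite Cprod_S, Cmod_mult; simpl; rewrite Rmult_comm.
      apply Rmult_le_compat; try apply Cmod_ge_0; [apply HuA; lia|apply IHm; intros; apply HuA; lia].
  - rewrite Nat.add_succ_r, Cprod_S, Cmod_mult; simpl.
    replace (A ^ m * (B * B ^ p)) with (A ^ m * B ^ p * B) by ring.
    apply Rmult_le_compat; try apply Cmod_ge_0; [apply IHp; intros; apply HuB; lia|apply HuB; lia].
Qed.

Lemma linear_factors_twice (n : nat) (x : nat -> C) (z : C) :
  fold_right Cmult (RtoC 1) (map (fun zeta => z - zeta)%C (map x (seq 0 n) ++ map x (seq 0 n)))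
  = (Cprod n (fun k => z - x k) * Cprod n (fun k => z - x k))%C.
Proof.
  assert (H : forall l l', fold_right Cmult (RtoC 1) (l ++ l')
    = (fold_right Cmult (RtoC 1) l * fold_right Cmult (RtoC 1) l')%C).
  { intros l l'; induction l as [|y l IH]; simpl; [ring|rewrite IH; ring]. }
  rewrite map_app, H, map_map; reflexivity.
Qed.

(** * Linearity and decay of the oscillatory functional *)

Section Quadrature.

Variables (a b : R) (g : R -> R) (s : bool).
Hypothesis Hab : a < b.
Hypothesis Hweight : zero_mean_periodic (fun t => g (phi s 1 t) - rho0 g / 2).

Lemma osc_weight_scale (om t : R) : osc_weight g s om t = g (phi s 1 (om * t)) - rho0 g / 2.
Proof. unfold osc_weight, phi; destruct s; rewrite Rmult_1_l; reflexivity. Qed.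

Lemma continuous_osc_weight (om t : R) : continuous (osc_weight g s om) t.
Proof.
  apply (continuous_ext (fun t => g (phi s 1 (om * t)) - rho0 g / 2)).
  - intros; symmetry; apply osc_weight_scale.
  - apply (continuous_comp (fun t => om * t) (fun t => g (phi s 1 t) - rho0 g / 2)); [|apply Hweight].
    apply (continuous_mult (K := R_AbsRing)); [apply continuous_const|apply continuous_id].
Qed.

Lemma is_RInt_I_O (om : R) (F : C -> C) :
  (forall t, a <= t <= b -> ccont (fun t => F (RtoC t)) t) ->
  is_RInt (V := CV) (fun t => F (RtoC t) * RtoC (osc_weight g s om t))%C a b (I_O a b g s om F).
Proof.
  intros HF; apply (RInt_correct (V := CV)), ex_CInt; [lra|]; intros t Ht.
  apply continuous_Cmult; [apply HF, Ht|apply continuous_RtoC, continuous_osc_weight].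
Qed.

Lemma I_O_plus_scal (om : R) (F P Q : C -> C) (c : C) :
  (forall t, a <= t <= b -> ccont (fun t => P (RtoC t)) t) ->
  (forall t, a <= t <= b -> ccont (fun t => Q (RtoC t)) t) ->
  (forall z, F z = P z + c * Q z)%C ->
  I_O a b g s om F = (I_O a b g s om P + c * I_O a b g s om Q)%C.
Proof.
  intros HP HQ H; unfold I_O at 1; apply (is_RInt_unique (V := CV)).
  eapply (is_RInt_ext (V := CV)); [|apply is_CInt_plus;
    [exact (is_RInt_I_O om P HP)|apply is_CInt_mult_l; exact (is_RInt_I_O om Q HQ)]].
  intros t _; cbv beta; rewrite H.
  match goal with |- ?l = ?r => change (@eq C l r) end; ring.
Qed.

Lemma continuous_poly (N : nat) (c : nat -> C) (t : R) :
  ccont (fun t => Csum N (fun i => c i * RtoC t ^ i)%C) t.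
Proof.
  induction N as [|N IH]; [apply continuous_const|].
  apply (continuous_ext (fun t => Csum N (fun i => c i * RtoC t ^ i) + c N * RtoC t ^ N)%C);
    [intros; symmetry; apply (Csum_S N)|].
  apply continuous_Cplus; trivial. apply continuous_Cmult; [apply continuous_const|].
  clear IH; induction N as [|N IH]; simpl; [apply continuous_const|].
  apply continuous_Cmult; trivial. apply continuous_RtoC, continuous_id.
Qed.

(** Exactness is assumed for real coefficients, while complex nodes and a complex-valued [F] give an
    interpolant with complex ones. *)
Lemma exact_on_complex_polynomials (om : R) (n N : nat) (x w : nat -> C) :
  (forall c : nat -> R,
     Csum n (fun k => w k * Csum N (fun i => RtoC (c i) * x k ^ i))%C
     = I_O a b g s om (fun z => Csum N (fun i => RtoC (c i) * z ^ i))%C) ->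
  forall c : nat -> C,
     Csum n (fun k => w k * Csum N (fun i => c i * x k ^ i))%C
     = I_O a b g s om (fun z => Csum N (fun i => c i * z ^ i))%C.
Proof.
  intros H c.
  assert (Hc : forall z, Csum N (fun i => c i * z ^ i)%C
    = (Csum N (fun i => RtoC (fst (c i)) * z ^ i) + Ci * Csum N (fun i => RtoC (snd (c i)) * z ^ i))%C).
  { intros z; rewrite <- Csum_mult_l, <- Csum_plus; apply Csum_ext; intros i _.
    replace (c i) with (RtoC (fst (c i)) + Ci * RtoC (snd (c i)))%C at 1
      by (destruct (c i); unfold RtoC, Ci, Cplus, Cmult; simpl; f_equal; ring).
    ring. }
  rewrite (I_O_plus_scal om _ _ _ Ci) with (3 := Hc); [|intros; apply continuous_poly..].
  rewrite <- !H, <- Csum_mult_l, <- Csum_plus. apply Csum_ext; intros k _. rewrite Hc; ring.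
Qed.

Lemma Cmod_I_O_le (om : R) (F : C -> C) :
  (forall t, a <= t <= b -> ccont (fun t => F (RtoC t)) t) ->
  Cmod (I_O a b g s om F)
  <= Rabs (RInt (fun t => fst (F (RtoC t)) * (g (phi s 1 (om * t)) - rho0 g / 2)) a b)
   + Rabs (RInt (fun t => snd (F (RtoC t)) * (g (phi s 1 (om * t)) - rho0 g / 2)) a b).
Proof.
  intros HF; pose proof (is_RInt_I_O om F HF) as H.
  pose proof (is_RInt_fct_extend_fst (U := R_NormedModule) (V := R_NormedModule) _ a b _ H) as H1.
  pose proof (is_RInt_fct_extend_snd (U := R_NormedModule) (V := R_NormedModule) _ a b _ H) as H2.
  eapply Rle_trans; [apply Cmod_le_abs|]; right; f_equal; f_equal; symmetry;
    apply is_RInt_unique.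
  - eapply (is_RInt_ext (V := R_NormedModule)); [|exact H1]. intros t _; simpl.
    rewrite osc_weight_scale. match goal with |- ?l = ?r => change (@eq R l r) end; ring.
  - eapply (is_RInt_ext (V := R_NormedModule)); [|exact H2]. intros t _; simpl.
    rewrite osc_weight_scale. match goal with |- ?l = ?r => change (@eq R l r) end; ring.
Qed.

(** Two scales meet here. On the circles of radius [/ om] around the endpoints, Cauchy's estimate
    gives j! (M2 / om^n) om^j for the derivative of order j <= n. On circles of radius [d / 2]
    around points of [a,b] it gives a bound for the order n+1 that is free of [om]. These are the
    inputs [A1] and [A2] of [oscillatory_integral_bound]; the final factor 2 adds real and imaginary
    parts. *)
Lemma I_O_bound (n : nat) (d : R) : 0 < d ->
  exists B, 0 <= B /\ forall om M1 M2 (G : C -> C), 1 <= om -> / om < d -> 0 <= M1 -> 0 <= M2 ->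
    (forall t z, a <= t <= b -> Cmod (z - RtoC t) < d -> cdiff G z /\ Cmod (G z) <= M1) ->
    (forall z, Cmod (z - RtoC a) = / om \/ Cmod (z - RtoC b) = / om -> Cmod (G z) <= M2 / om ^ n) ->
    Cmod (I_O a b g s om G) <= B * (M1 + M2) / om ^ (n + 1).
Proof.
  intros Hd.
  destruct (oscillatory_integral_bound a b (S n) Hab _ Hweight) as [B [HB Hosc]].
  (* [L] is Cauchy's constant for order n+1 on radius [d / 2]; [N] below dominates j! for all orders
     at the endpoints. *)
  set (L := INR (fact (S n)) / (d / 2) ^ S n).
  assert (HL : 0 <= L).
  { apply Rle_mult_inv_pos; [apply pos_INR|apply pow_lt; lra]. }
  set (N := INR (fact n)).
  assert (HN : 0 <= N) by apply pos_INR.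
  exists (2 * B * (N + L)); split; [nra|].
  intros om M1 M2 G Hom Hdom HM1 HM2 HG Hends.
  assert (Hiom : 0 < / om) by (apply Rinv_0_lt_compat; lra).
  assert (Hpn : 0 < om ^ n) by (apply pow_lt; lra).
  assert (HpSn : 0 < om ^ S n) by (apply pow_lt; lra).
  assert (HGc : forall t, a <= t <= b -> ccont (fun t => G (RtoC t)) t).
  { intros t Ht; apply (continuous_comp RtoC G); [apply continuous_RtoC, continuous_id|].
    apply cdiff_continuous, (HG t); trivial.
    replace (RtoC t - RtoC t)%C with (RtoC 0) by ring; rewrite Cmod_0; trivial. }
  assert (Hpart : forall u : R -> R,
    (forall t, a <= t <= b -> exists e, expansion u t (d / 2) M1 e) ->
    (exists e, expansion u a (/ om) (M2 / om ^ n) e) ->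
    (exists e, expansion u b (/ om) (M2 / om ^ n) e) ->
    Rabs (RInt (fun t => u t * (g (phi s 1 (om * t)) - rho0 g / 2)) a b)
    <= B * (N + L) * (M1 + M2) / om ^ (n + 1)).
  { intros u Hu [ea Hua] [eb Hub].
    assert (HA : forall c e, expansion u c (/ om) (M2 / om ^ n) e -> forall j, (j < S n)%nat ->
      Rabs (Derive_n u j c) <= N * M2 / om ^ n * om ^ j).
    { intros c e He j Hj.
      eapply Rle_trans; [exact (proj2 (expansion_derive_bound u c _ _ e j Hiom He))|].
      rewrite pow_inv. replace (M2 / om ^ n / / om ^ j) with (M2 / om ^ n * om ^ j)
        by (field; split; apply pow_nonzero; lra).
      replace (N * M2 / om ^ n * om ^ j) with (N * (M2 / om ^ n * om ^ j)) by (unfold Rdiv; ring).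
      apply Rmult_le_compat_r.
      - apply Rmult_le_pos; [apply Rle_mult_inv_pos; trivial|apply pow_le; lra].
      - apply le_INR, fact_le; lia. }
    eapply Rle_trans; [apply (Hosc om (N * M2 / om ^ n) (L * M1 / om ^ S n) (Derive_n u) Hom)|].
    - apply Rle_mult_inv_pos; trivial; apply Rmult_le_pos; trivial.
    - apply Rle_mult_inv_pos; trivial; apply Rmult_le_pos; trivial.
    - intros j t Ht; destruct (Hu t Ht) as [e He].
      exact (proj1 (expansion_derive_bound u t (d / 2) _ e j ltac:(lra) He)).
    - intros j Hj; split; [exact (HA a ea Hua j Hj)|exact (HA b eb Hub j Hj)].
    - intros t Ht; destruct (Hu t Ht) as [e He].
      eapply Rle_trans; [exact (proj2 (expansion_derive_bound u t (d / 2) _ e (S n) ltac:(lra) He))|].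
      assert (HY : (d / 2) ^ S n <> 0) by (apply pow_nonzero; lra).
      right; unfold L; revert HY HpSn; generalize ((d / 2) ^ S n) (om ^ S n); intros Y X HY HX.
      field; split; lra.
    - rewrite Nat.add_1_r.
      replace (B * (N * M2 / om ^ n / om + L * M1 / om ^ S n)) with (B * (N * M2 + L * M1) / om ^ S n)
        by (simpl pow; field; lra).
      apply Rmult_le_compat_r; [left; apply Rinv_0_lt_compat; trivial|].
      rewrite Rmult_assoc; apply Rmult_le_compat_l; trivial. nra. }
  assert (Hmid : forall t, a <= t <= b ->
    (exists e, expansion (fun t => fst (G (RtoC t))) t (d / 2) M1 e) /\
    (exists e, expansion (fun t => snd (G (RtoC t))) t (d / 2) M1 e)).
  { intros t Ht; apply (taylor_real G t d); [lra| |].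
    - intros z Hz; apply (HG t z Ht Hz).
    - intros th; apply (HG t _ Ht). rewrite Cmod_circle; lra. }
  assert (Ha : (exists e, expansion (fun t => fst (G (RtoC t))) a (/ om) (M2 / om ^ n) e) /\
    (exists e, expansion (fun t => snd (G (RtoC t))) a (/ om) (M2 / om ^ n) e)).
  { apply (taylor_real G a d); [lra| |].
    - intros z Hz; apply (HG a z ltac:(lra) Hz).
    - intros th; apply Hends; left; apply Cmod_circle; lra. }
  assert (Hb : (exists e, expansion (fun t => fst (G (RtoC t))) b (/ om) (M2 / om ^ n) e) /\
    (exists e, expansion (fun t => snd (G (RtoC t))) b (/ om) (M2 / om ^ n) e)).
  { apply (taylor_real G b d); [lra| |].
    - intros z Hz; apply (HG b z ltac:(lra) Hz).
    - intros th; apply Hends; right; apply Cmod_circle; lra. }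
  eapply Rle_trans; [apply Cmod_I_O_le, HGc|].
  pose proof (Hpart _ (fun t Ht => proj1 (Hmid t Ht)) (proj1 Ha) (proj1 Hb)) as H1.
  pose proof (Hpart _ (fun t Ht => proj2 (Hmid t Ht)) (proj2 Ha) (proj2 Hb)) as H2.
  cbv beta in H1, H2.
  replace (2 * B * (N + L) * (M1 + M2) / om ^ (n + 1))
    with (B * (N + L) * (M1 + M2) / om ^ (n + 1) + B * (N + L) * (M1 + M2) / om ^ (n + 1))
    by (unfold Rdiv; ring).
  lra.
Qed.

End Quadrature.

Theorem theorem3p1
  (a b : R) (g : R -> R) (s : bool) (n : nat)
  (x w : R -> nat -> C)
  (Hab : a < b)
  (* g >= 0 on [-1,1] *)
  (Hg_nonneg : forall t, -1 <= t <= 1 -> 0 <= g t)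
  (* g is analytic in the disc |z| < r for some r > 1 *)
  (Hg_analytic : exists r, 1 < r /\ exists G : C -> C,
      (forall z, Cmod z < r -> holo_at G z) /\
      (forall t, -1 <= t <= 1 -> G (RtoC t) = RtoC (g t)))
  (* n even and positive *)
  (Hn_even : Nat.Even n) (Hn_pos : (0 < n)%nat)
  (* for all sufficiently large omega: x omega 0, ..., x omega (n-1) are
     the distinct zeros of a monic degree-n polynomial q_n^omega which is
     orthogonal to 1, ..., x^(n-1), and w omega k are Gaussian weights *)
  (Hgauss : exists Om0, forall om, Om0 <= om ->
      (forall i j, (i < n)%nat -> (j < n)%nat -> i <> j -> x om i <> x om j) /\
      (forall j, (j < n)%nat ->
         I_O a b g s om
           (fun z => Cmult (Cprod n (fun k => Cminus z (x om k))) (Cpow z j))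
         = RtoC 0) /\
      (forall c : nat -> R,
         Csum n (fun k => Cmult (w om k)
                   (Csum (2 * n) (fun i => Cmult (RtoC (c i)) (Cpow (x om k) i))))
         = I_O a b g s om
             (fun z => Csum (2 * n) (fun i => Cmult (RtoC (c i)) (Cpow z i)))))
  (* nodes split: the first n/2 nodes are a + O(1/omega), the last n/2 are
     b + O(1/omega) *)
  (Hnodes : exists K Om1, forall om, Om1 <= om ->
      (forall k, (k < n / 2)%nat -> Cmod (Cminus (x om k) (RtoC a)) <= K / om) /\
      (forall k, (n / 2 <= k < n)%nat -> Cmod (Cminus (x om k) (RtoC b)) <= K / om)) :
  forall (F : C -> C) (U : C -> Prop),
    open U ->
    (forall t, a <= t <= b -> U (RtoC t)) ->
    (forall z, U z -> holo_at F z) ->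
    exists K Om2, forall om, Om2 <= om ->
      Cmod (Cminus (I_O a b g s om F)
                   (Csum n (fun k => Cmult (w om k) (F (x om k)))))
        <= K / om ^ (n + 1).
Proof.
  intros F U HU HabU HF.
  assert (Hweight := zero_mean_osc_weight g s Hg_analytic).
  destruct Hgauss as [Om0 HG0]; destruct Hnodes as (K & Om1 & HN).
  destruct (segment_neighborhood a b F U ltac:(lra) HU HabU) as (d & M & Hd & HM).
  { intros z Hz; apply holo_at_cdiff, HF, Hz. }
  destruct (I_O_bound a b g s Hab Hweight n d Hd) as [B [HB Hbound]].
  set (m := (n / 2)%nat).
  assert (Hm : n = (m + m)%nat).
  { destruct Hn_even as [j Hj]; unfold m; rewrite Hj, Nat.mul_comm, Nat.div_mul; lia. }
  set (V z := exists t, a <= t <= b /\ Cmod (z - RtoC t) < d).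
  assert (HM0 : 0 <= M).
  { apply Rle_trans with (Cmod (F (RtoC a))); [apply Cmod_ge_0|].
    apply (HM a); [lra|]. replace (RtoC a - RtoC a)%C with (RtoC 0) by ring; rewrite Cmod_0; trivial. }
  (* [K] carries no sign condition; [Kp] is a positive replacement. *)
  set (Kp := Rabs K + 1).
  assert (HKp : 0 < Kp /\ K <= Kp).
  { unfold Kp; pose proof (Rabs_pos K); pose proof (Rle_abs K); lra. }
  (* Bounds the distance from a point of [V] to a node: at most [d] and [d / 2] to reach [a,b] from
     either, and b - a along it. *)
  set (D := b - a + 2 * d).
  (* The bound on [h] for 2n nodes with interpolation radius [d / 4]: the disc of radius [d / 2]
     about a node that is within [d / 2] of [a,b] stays in [V]. *)
  set (H := (4 / (d / 4)) ^ (2 * n) * M).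
  assert (HH : 0 <= H).
  { apply Rmult_le_pos; trivial. apply pow_le, Rle_mult_inv_pos; lra. }
  set (M1 := D ^ n * D ^ n * H).
  (* On a circle of radius 1/omega about an endpoint, n/2 factors of q are at most (1 + Kp)/omega
     and the other n/2 at most [D]; squaring the product gives ((1 + Kp) D)^n / omega^n. *)
  set (M2 := ((1 + Kp) * D) ^ n * H).
  assert (HM1 : 0 <= M1).
  { apply Rmult_le_pos; trivial; apply Rmult_le_pos; apply pow_le; unfold D; lra. }
  assert (HM2 : 0 <= M2).
  { apply Rmult_le_pos; trivial; apply pow_le, Rmult_le_pos; unfold D; lra. }
  (* The threshold [2 / d] puts the circles of radius [/ om] inside [V], and [4 * Kp / d] puts the
     nodes within [d / 2] of their endpoint. *)
  exists (B * (M1 + M2)), (Rmax (Rmax Om0 Om1) (Rmax 1 (Rmax (2 / d) (4 * Kp / d)))).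
  intros om Hom.
  assert (Homs : Om0 <= om /\ Om1 <= om /\ 1 <= om /\ 2 / d <= om /\ 4 * Kp / d <= om).
  { repeat split; (eapply Rle_trans; [|exact Hom]); eauto using Rmax_l, Rmax_r, Rle_trans. }
  destruct Homs as (Ho0 & Ho1 & Ho2 & Ho3 & Ho4).
  destruct (HG0 om Ho0) as (_ & _ & Hexact); destruct (HN om Ho1) as [Hna Hnb].
  clear HG0 HN Hom.
  assert (Hiom : 0 < / om) by (apply Rinv_0_lt_compat; lra).
  assert (Hiomd : / om < d).
  { apply (Rmult_lt_reg_l om); [lra|]. rewrite Rinv_r by lra.
    apply (Rmult_le_compat_r d) in Ho3; [|lra].
    replace (2 / d * d) with 2 in Ho3 by (field; lra). lra. }
  assert (HKom : Kp / om < d / 2).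
  { apply (Rmult_lt_reg_l om); [lra|]. replace (om * (Kp / om)) with Kp by (field; lra).
    apply (Rmult_le_compat_r d) in Ho4; [|lra].
    replace (4 * Kp / d * d) with (4 * Kp) in Ho4 by (field; lra). lra. }
  assert (HKK : K / om <= Kp / om) by (apply Rmult_le_compat_r; lra).
  set (xs := x om) in *.
  assert (Hnode : forall k, (k < n)%nat -> exists c, a <= c <= b /\ Cmod (xs k - RtoC c) < d / 2).
  { intros k Hk; destruct (le_lt_dec m k) as [Hmk|Hmk].
    - exists b; split; [lra|]. specialize (Hnb k (conj Hmk Hk)); lra.
    - exists a; split; [lra|]. specialize (Hna k Hmk); lra. }
  set (l := map xs (seq 0 n) ++ map xs (seq 0 n)).
  assert (Hlen : length l = (2 * n)%nat).
  { unfold l; rewrite length_app, !length_map, length_seq; lia. }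
  assert (Hl : forall zeta, In zeta l -> exists k, (k < n)%nat /\ zeta = xs k).
  { intros zeta Hz; apply in_app_or in Hz.
    assert (Hz' : In zeta (map xs (seq 0 n))) by tauto.
    apply in_map_iff in Hz'; destruct Hz' as [k [<- Hk]]; apply in_seq in Hk.
    exists k; split; [lia|reflexivity]. }
  destruct (newton_interpolation V (d / 4) l ltac:(lra)) with (F := F) (M := M)
    as (c & h & _ & Hh1 & Hh2 & HFP).
  { intros zeta z Hz Hzd; destruct (Hl zeta Hz) as [k [Hk ->]].
    destruct (Hnode k Hk) as [t [Ht Hkt]]; exists t; split; trivial.
    replace (z - RtoC t)%C with ((z - xs k) + (xs k - RtoC t))%C by ring.
    eapply Rle_lt_trans; [apply Cmod_triangle|lra]. }
  { intros z [t [Ht Hz]]; apply holo_at_cdiff, HF, (HM t z Ht Hz). }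
  { intros z [t [Ht Hz]]; apply (HM t z Ht Hz). }
  rewrite Hlen in Hh2, HFP.
  set (q z := Cprod n (fun k => z - xs k)%C).
  set (G z := (fold_right Cmult (RtoC 1) (map (fun zeta => z - zeta)%C l) * h z)%C).
  set (P z := Csum (2 * n) (fun i => c i * z ^ i)%C).
  assert (HGq : forall z, G z = (q z * q z * h z)%C).
  { intros z; unfold G, l; rewrite linear_factors_twice; reflexivity. }
  (* [F] and [P] agree where [q] vanishes, so the rule cannot tell them apart; on [P], of degree at
     most 2n-1, it is exact. *)
  assert (Hquad : Csum n (fun k => Cmult (w om k) (F (xs k))) = I_O a b g s om P).
  { unfold P; rewrite <- (exact_on_complex_polynomials a b g s Hab Hweight om n (2 * n) xs (w om) Hexact c).
    apply Csum_ext; intros k Hk; f_equal. rewrite HFP. fold (G (xs k)). rewrite HGq.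
    replace (q (xs k)) with (RtoC 0); [ring|].
    symmetry; apply (Cprod_eq_0 n k); trivial; ring. }
  assert (HGd : forall z, V z -> cdiff G z).
  { intros z Hz; apply cdiff_linear_factors, Hh1, Hz. }
  assert (HVc : forall t, a <= t <= b -> V (RtoC t)).
  { intros t Ht; exists t; split; trivial.
    replace (RtoC t - RtoC t)%C with (RtoC 0) by ring; rewrite Cmod_0; trivial. }
  assert (Herr : (I_O a b g s om F - I_O a b g s om P)%C = I_O a b g s om G).
  { rewrite (I_O_plus_scal a b g s Hab Hweight om F P G 1).
    - ring.
    - intros; apply continuous_poly.
    - intros t Ht; apply (continuous_comp RtoC G); [apply continuous_RtoC, continuous_id|].
      apply cdiff_continuous, HGd, HVc, Ht.
    - intros z; rewrite HFP; unfold P, G; ring. }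
  rewrite Hquad, Herr.
  assert (Hfar : forall z k, V z -> (k < n)%nat -> Cmod (z - xs k) <= D).
  { intros z k [t [Ht Hz]] Hk; destruct (Hnode k Hk) as [t' [Ht' Hk']].
    replace (z - xs k)%C with ((z - RtoC t) + (RtoC (t - t') + - (xs k - RtoC t')))%C
      by (rewrite RtoC_minus; ring).
    eapply Rle_trans; [apply Cmod_triangle|].
    eapply Rle_trans; [apply Rplus_le_compat_l, Cmod_triangle|].
    rewrite Cmod_opp, Cmod_R.
    assert (Rabs (t - t') <= b - a) by (apply Rabs_le; lra). unfold D; lra. }
  assert (HD : 0 <= D) by (unfold D; lra).
  apply Hbound; trivial.
  - intros t z Ht Hz.
    assert (HVz : V z) by (exists t; split; trivial).
    split; [apply HGd, HVz|].
    rewrite HGq, !Cmod_mult.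
    assert (Hq : Cmod (q z) <= D ^ n).
    { unfold q; pose proof (Cmod_Cprod_le n 0 (fun k => z - xs k)%C D D HD HD) as Hp.
      rewrite Nat.add_0_r, Rmult_1_r in Hp. apply Hp; [intros; apply Hfar; trivial|intros; lia]. }
    apply Rmult_le_compat; [apply Rmult_le_pos; apply Cmod_ge_0|apply Cmod_ge_0| |apply Hh2, HVz].
    apply Rmult_le_compat; trivial; apply Cmod_ge_0.
  - intros z Hz.
    assert (HVz : V z) by (destruct Hz as [Hz|Hz]; [exists a|exists b]; split; lra).
    assert (HA : 0 <= (1 + Kp) / om) by (apply Rle_mult_inv_pos; lra).
    assert (Hq : Cmod (q z) <= ((1 + Kp) / om) ^ m * D ^ m).
    { unfold q; rewrite Hm. destruct Hz as [Hz|Hz].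
      - apply Cmod_Cprod_le; trivial; intros k Hk; [|apply Hfar; trivial; lia].
        replace (z - xs k)%C with ((z - RtoC a) - (xs k - RtoC a))%C by ring.
        eapply Rle_trans; [apply Cmod_minus_le|]. rewrite Hz.
        specialize (Hna k Hk). unfold Rdiv in *; lra.
      - rewrite Rmult_comm.
        apply Cmod_Cprod_le; trivial; intros k Hk; [apply Hfar; trivial; lia|].
        replace (z - xs k)%C with ((z - RtoC b) - (xs k - RtoC b))%C by ring.
        eapply Rle_trans; [apply Cmod_minus_le|]. rewrite Hz.
        specialize (Hnb k ltac:(fold m; lia)). unfold Rdiv in *; lra. }
    rewrite HGq, !Cmod_mult.
    replace (M2 / om ^ n) with (((1 + Kp) / om) ^ m * D ^ m * (((1 + Kp) / om) ^ m * D ^ m) * H).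
    + apply Rmult_le_compat; [apply Rmult_le_pos; apply Cmod_ge_0|apply Cmod_ge_0| |apply Hh2, HVz].
      apply Rmult_le_compat; trivial; apply Cmod_ge_0.
    + unfold M2; rewrite Hm, !pow_add; unfold Rdiv; rewrite !Rpow_mult_distr, pow_inv.
      field. apply pow_nonzero; lra.
Qed.
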